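(* For any $k$ and any degree $d$ we have $$A_k(z)=e^{\mu_1 z}B_k(z),$$ where $B_k\in\mathbb{C}(d)[\mu_1,\dots,\mu_k][z]$ is a universal polynomial in $z$ with coefficients in $\mathbb{C}(d)[\mu_1,\dots,\mu_k]$.
   Context: Let $\mathcal{Q}(t)=\prod_{i=1}^d(t+r_i)$ be a complex polynomial of degree $d$ with leading coefficient $1$, and let $\vec r=(r_1,\dots,r_d)\in\mathbb{C}^d$. For a positive integer $n$ and $z\in\mathbb{C}$ with $\operatorname{Re}z>0$, set $$\mathcal{F}_n(\mathcal{Q},z)=\frac{z^{dn+1}}{(dn)!}\int_0^\infty e^{-zt}\,\mathcal{Q}(t)^n\,dt .$$ Set $\mu_s=\mu_s(\vec r)=\frac1d\sum_{i=1}^d r_i^s$, and let $\mathbb{C}(d)$ denote the field of rational functions in the variable $d=\deg\mathcal{Q}$. The functions $A_k(z)$, $k\ge 0$, are the holomorphic functions on $\mathbb{C}$ that are the coefficients of the asymptotic expansion $\mathcal{F}_n(\mathcal{Q},z)=\sum_{k=0}^\infty A_k(z)n^{-k}$ as $n\to\infty$, valid for every $z$ with $\operatorname{Re}z>0$; that is, for every $\ell\ge 0$, $\mathcal{F}_n(\mathcal{Q},z)-\sum_{k=0}^{\ell}A_k(z)n^{-k}=O(n^{-\ell-1})$ as $n\to\infty$.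
   Formalization: For k ≥ 1 the coefficients of B_k lie in C(d)[μ_1,…,μ_{k+1}] instead of C(d)[μ_1,…,μ_k]; the printed claim fails for Q = t²−a², where μ_1 = 0 but A_1(z) = −μ_2 z²/4. *)

(* Defs.v *)
From mathcomp Require Import all_boot all_order all_algebra.
From mathcomp Require Import all_classical all_reals all_analysis.
From mathcomp Require Import complex.
(* The notations of mpoly clash with those of mathcomp-analysis. *)
From mathcomp Require Import(canonicals,coercions) mpoly.

Set Implicit Arguments.
Unset Strict Implicit.
Unset Printing Implicit Defensive.

Import Order.TTheory GRing.Theory Num.Theory.
Import numFieldNormedType.Exports.

Local Open Scope classical_set_scope.
Local Open Scope ring_scope.
Local Open Scope complex_scope.

Definition expC (R : realType) (z : R[i]) : R[i] :=
  (expR (complex.Re z))%:C *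
  (cos (complex.Im z) +i* sin (complex.Im z)).

Definition Cintegral (R : realType) (D : set R) (f : R -> R[i]) : R[i] :=
  Rintegral (@lebesgue_measure R) D (fun t => complex.Re (f t)) +i*
  Rintegral (@lebesgue_measure R) D (fun t => complex.Im (f t)).

(* Complex differentiability on the whole plane: [R[i]^o] is a normed module
   over [R[i]], so the increments in [derivable] are complex. *)
Definition entire (R : realType) (f : R[i] -> R[i]) : Prop :=
  forall z : R[i], derivable (f : R[i]^o -> R[i]^o) z 1.

(* The roots of [Qpoly r] are the opposites of the [r i]. *)
Definition Qpoly (R : realType) (d : nat) (r : 'I_d -> R[i]) : {poly R[i]} :=
  \prod_(i < d) ('X + (r i)%:P).

Definition Fn (R : realType) (Q : {poly R[i]}) (n : nat) (z : R[i]) : R[i] :=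
  let d := (size Q).-1 in
  z ^+ (d * n + 1) / ((d * n)`!)%:R *
  Cintegral `[0, +oo[ (fun t : R => expC (- (z * t%:C)) * Q.[t%:C] ^+ n).

Definition is_asymptotic_expansion (R : realType) (Q : {poly R[i]})
    (A : nat -> R[i] -> R[i]) : Prop :=
  forall z : R[i], 0 < complex.Re z -> forall l : nat,
    (fun n : nat => Fn Q n z - \sum_(k < l.+1) A k z * n%:R ^- k : R[i]^o)
    =O_\oo (fun n : nat => n%:R ^- l.+1 : R[i]^o).

Definition mu (R : realType) (d : nat) (r : 'I_d -> R[i]) (s : nat) : R[i] :=
  d%:R^-1 * \sum_(i < d) r i ^+ s.

(* The rational function [f] has no pole at [x] and takes the value [v] there;
   [p] and [q] need not be coprime, and [v] does not depend on them. *)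
Definition ratfun_value (F : fieldType) (f : {fraction {poly F}}) (x v : F) :
    Prop :=
  exists p q : {poly F},
    [/\ q.[x] != 0, f = tofrac p / tofrac q & v = p.[x] / q.[x]].

(* [E] is obtained from [B] by evaluating at [x] all the rational functions that
   occur as coefficients; in particular none of them has a pole at [x]. *)
Definition specialization (F : fieldType) (m : nat)
    (B : {poly mpoly.mpoly m {fraction {poly F}}}) (x : F)
    (E : {poly mpoly.mpoly m F}) : Prop :=
  forall (j : nat) (a : mpoly.multinom m),
    ratfun_value (mpoly.mcoeff a B`_j) x (mpoly.mcoeff a E`_j).

(* The variable of index [i] of the coefficients of [E] stands for the power
   mean of exponent [i + 1]. *)
Definition eval_at (R : realType) (d m : nat) (E : {poly mpoly.mpoly m R[i]})
    (r : 'I_d -> R[i]) (z : R[i]) : R[i] :=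
  (map_poly (mpoly.meval (fun i : 'I_m => mu r i.+1)) E).[z].

(* Number of power means occurring in the k-th coefficient: none for k = 0, and
   the first k + 1 for k > 0. The first k alone do not suffice: for d = 2 and
   r = (a, - a) the integral is a finite sum, giving
   A_1(z) = - a^2 z^2 / 4 = - mu_2 z^2 / 4, whereas mu_1 = 0. *)
Definition nb_means (k : nat) : nat := if k is k'.+1 then k'.+2 else 0.

(* Main.v *)
From HB Require Import structures.
Require Import Defs.
From mathcomp Require Import all_boot all_order all_algebra.
From mathcomp Require Import all_classical all_reals all_analysis.
From mathcomp Require Import measurable_realfun complex.
From mathcomp Require Import(canonicals,coercions) mpoly.
From mathcomp Require Import ring lra zify.

(**
Expanding Q^n and integrating term by term, F_n(Q, z) is the finite sum over j
of c_j z^j (N - j)! / N!, where N = d n and c_j is the coefficient of x^j in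
prod_i (1 + r_i x)^n. By Newton's identities, with x = 1/N,
  sum_j c_j x^j z^j = exp(sum_(s >= 1) (-1)^(s-1) mu_s x^(s-1) z^s / s)
    = e^(mu_1 z) sum_w u_w(z) x^w,
where u_w is a polynomial in z, mu_2, ..., mu_(w+1), while
N^j (N - j)! / N! = prod_(i < j) (1 - i x)^-1 = sum_m h_m(j) x^m, where h_m is a
polynomial. Multiplying the coefficient of z^j by h_m(j) amounts to applying
h_m(z d/dz), which preserves e^(mu_1 z) C[mu][z]. Bounds of the remainders by
K^j / j! allow summation over j, so for Re z > 0 the asymptotic expansion exists
in powers of 1/N with coefficients in e^(mu_1 z) C[mu][z], and it is unique.

The coefficients A_k being only assumed entire, the formula is extended to the
whole plane by the identity theorem: if f is complex differentiable and vanishes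
for Re z > 0, Goursat's lemma yields a primitive F of f vanishing there too; F is
twice differentiable, so the maximum principle follows from the second-order
Taylor expansion, and applied to F(z) / (z - b)^n with n -> oo it gives F = 0.
*)

Set Implicit Arguments.
Unset Strict Implicit.
Unset Printing Implicit Defensive.

Import Order.TTheory GRing.Theory Num.Theory.
Import numFieldNormedType.Exports.
Import Normc.

Local Open Scope ring_scope.

(** * Newton's identities and the formal expansion *)

(** The estimates have to be uniform in j, because the number of terms grows with n, and two ranges
    of j behave differently. For 2 j <= N the factors 1 - i x with i < j are at least 1/2, so the
    two expansions can be multiplied together with their remainders. For 2 j > N no cancellation is
    sought: x^L (2 j)^L >= 1, so bounding every term separately already yields x^L, up to a power of
    j that K^j absorbs. All identities are between finite sums; a series in z only occurs through
    partial sums that are long enough. The variable d enters when powers of 1 / N become powers of 1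
    / n, which multiplies the coefficient of index k by d^(-k); 0 is therefore the only possible
    pole. The recursion for u_w ends with mu_(w+1), which is the source of the k + 1 means. In the
    identity theorem, the detour through a primitive supplies a second-order expansion at every
    point, which a single complex derivative of f does not give directly. *)

Section RootProducts.
Variable F : fieldType.
Implicit Types (ts : seq F) (t : F).

Lemma size_prod_XaddC ts : size (\prod_(t <- ts) ('X + t%:P)) = (size ts).+1.
Proof.
rewrite (eq_bigr (fun t => 'X - (- t)%:P)); last by move=> t _; rewrite polyCN opprK.
exact: size_prod_XsubC.
Qed.

Lemma size_prod_1addX ts : (size (\prod_(t <- ts) (1 + t *: 'X))%R <= (size ts).+1)%N.
Proof.
elim: ts => [|t ts IH]; first by rewrite big_nil size_poly1.
rewrite big_cons mulrDl mul1r -scalerAl (leq_trans (size_polyD _ _)) // geq_max.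
rewrite (leq_trans IH) ?leqnSn // (leq_trans (size_scale_leq _ _)) //.
by rewrite mulrC (leq_trans (size_polyMleq _ _)) // size_polyX addn2.
Qed.

(** The Laplace transform attaches z^j to the coefficient of index N - j of Q^n; reversal makes it a
    coefficient of a product with constant term 1, to which Newton's identities apply. *)
Lemma coef_prod_reverse ts j : (j <= size ts)%N ->
  (\prod_(t <- ts) ('X + t%:P))`_(size ts - j) =
  (\prod_(t <- ts) (1 + t *: 'X))`_j.
Proof.
elim: ts j => [|t ts IH] j; first by rewrite leqn0 => /eqP->; rewrite !big_nil.
set P := \prod_(t <- ts) ('X + _) in IH; set Q := \prod_(t <- ts) (1 + _) in IH.
rewrite !big_cons -/P -/Q /= !mulrDl !mul1r -scalerAl !coefD coefZ !coefXM coefCM.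
case: j => [|j] jts.
  rewrite subn0 /= mulr0 addr0 -(IH 0%N) // subn0.
  by rewrite [P`_(size ts).+1]nth_default ?mulr0 ?addr0 // size_prod_XaddC.
rewrite subSS /=; rewrite ltnS in jts; rewrite IH //; congr (_ + _).
move: jts; rewrite leq_eqVlt => /orP[/eqP->|jts].
  by rewrite subnn eqxx nth_default // size_prod_1addX.
by rewrite subn_eq0 leqNgt jts -subnS IH.
Qed.

(* Logarithmic derivative modulo 'X^J: each factor 1 + t X contributes
   t / (1 + t X) = sum_s (-1)^s t^(s+1) X^s. *)
Lemma deriv_prod_1addX ts J : exists a,
  (\prod_(t <- ts) (1 + t *: 'X))^`() =
  (\sum_(s < J) ((-1) ^+ s * \sum_(t <- ts) t ^+ s.+1) *: 'X^s) *
    \prod_(t <- ts) (1 + t *: 'X) + 'X^J * a.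
Proof.
elim: ts => [|t ts [a IH]].
  exists 0; rewrite !big_nil derivC mulr0 addr0 big1 ?mul0r // => s _.
  by rewrite big_nil mulr0 scale0r.
set Q := \prod_(t <- ts) _ in IH; set S := \sum_(s < J) _ in IH.
pose T := \sum_(s < J) ((-1) ^+ s * t ^+ s.+1) *: 'X^s : {poly F}.
have TE : t%:P = (1 + t *: 'X) * T + 'X^J * (t *: ((- t) ^+ J)%:P).
  have -> : T = t%:P * \sum_(s < J) (- (t *: 'X)) ^+ s.
    rewrite mulr_sumr; apply: eq_bigr => s _; rewrite mul_polyC -scaleNr exprZn scalerA.
    by congr (_ *: _); rewrite exprS [(- t) ^+ _]exprNn mulrCA.
  have := subrX1 (- (t *: 'X) : {poly F}) J.
  rewrite -scaleNr exprZn => E.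
  have -> : 'X^J * (t *: ((- t) ^+ J)%:P) = t%:P * ((- t) ^+ J *: 'X^J).
    by rewrite -!mul_polyC; ring.
  have -> : (- t) ^+ J *: 'X^J = (- t *: 'X - 1) * (\sum_(i < J) (- t *: 'X) ^+ i) + 1.
    by rewrite -E subrK.
  by rewrite -!mul_polyC polyCN; ring.
rewrite big_cons -/Q derivM derivD derivC derivZ derivX add0r IH alg_polyC.
exists ((t *: ((- t) ^+ J)%:P) * Q + (1 + t *: 'X) * a).
have -> : \sum_(s < J) ((-1) ^+ s * \sum_(t' <- t :: ts) t' ^+ s.+1) *: 'X^s = T + S.
  rewrite -big_split; apply: eq_bigr => s _; rewrite big_cons mulrDr scalerDl //.
rewrite {1}TE; ring.
Qed.

(** Coefficient of index j of the logarithmic derivative taken modulo X^(j+1), where the remainder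
    does not contribute. *)
Lemma newton_coef ts j :
  j.+1%:R * (\prod_(t <- ts) (1 + t *: 'X))`_j.+1 =
  \sum_(s < j.+1) (-1) ^+ s * (\sum_(t <- ts) t ^+ s.+1) *
    (\prod_(t <- ts) (1 + t *: 'X))`_(j - s).
Proof.
have [a] := deriv_prod_1addX ts j.+1; set Q := \prod_(t <- ts) _ => /polyP/(_ j).
rewrite coef_deriv coefD coefXnM ltnSn addr0 coefM mulr_natl => ->.
apply: eq_bigr => s _; congr (_ * _).
rewrite coef_sum (bigD1 s) //= coefZ coefXn eqxx mulr1 [X in _ + X]big1 ?addr0 // => i si.
by rewrite coefZ coefXn eq_sym (inj_eq val_inj) (negbTE si) mulr0.
Qed.

End RootProducts.

(** The coefficients are dominated by those of (1 + rho X)^(size ts); the induction is Pascal's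
    rule. *)
Lemma coef_prod_1addX_bound (F : numFieldType) (ts : seq F) (rho : F) j :
  (forall t, t \in ts -> `|t| <= rho) ->
  `|(\prod_(t <- ts) (1 + t *: 'X))`_j| <= 'C(size ts, j)%:R * rho ^+ j.
Proof.
elim: ts j => [|t ts IH] j tsr.
  rewrite big_nil coef1; case: j => [|j]; first by rewrite normr1 mulr1.
  by rewrite normr0 mul0r.
have tr : `|t| <= rho by apply: tsr; rewrite mem_head.
have {}IH i := IH i (fun t' t'in => tsr t' (@mem_behead _ (t :: ts) t' t'in)).
rewrite big_cons mulrDl mul1r -scalerAl coefD coefZ coefXM.
case: j => [|j] /=; first by rewrite mulr0 addr0 (le_trans (IH _)) // !bin0.
rewrite binS natrD mulrDl (le_trans (ler_normD _ _)) // lerD //.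
by rewrite normrM exprS mulrCA ler_pM.
Qed.

(** * Power series of e^(mu_1 z) p(z) and the polynomials u_w *)

Section Expansion.
Variables (F : numFieldType) (mu : nat -> F).

(* Coefficients of [e^(mu_1 z) p(z)] as a power series in z. *)
Definition exp_conv (p : {poly F}) (j : nat) : F :=
  \sum_(i < j.+1) p`_i * mu 1 ^+ (j - i) / (j - i)`!%:R.

Lemma exp_convD p q j : exp_conv (p + q) j = exp_conv p j + exp_conv q j.
Proof. by rewrite -big_split; apply: eq_bigr => i _; rewrite coefD !mulrDl. Qed.

Lemma exp_convZ a p j : exp_conv (a *: p) j = a * exp_conv p j.
Proof. by rewrite /exp_conv mulr_sumr; apply: eq_bigr => i _; rewrite coefZ !mulrA. Qed.

Lemma exp_conv0 j : exp_conv 0 j = 0.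
Proof. by rewrite -(scale0r 0) exp_convZ mul0r. Qed.

Lemma exp_conv_sum I (r : seq I) (P : pred I) (p : I -> {poly F}) j :
  exp_conv (\sum_(i <- r | P i) p i) j = \sum_(i <- r | P i) exp_conv (p i) j.
Proof.
apply: (big_morph (exp_conv^~ j)) => [p1 p2|]; [exact: exp_convD|exact: exp_conv0].
Qed.

Lemma exp_convXS p j : exp_conv ('X * p) j.+1 = exp_conv p j.
Proof.
rewrite /exp_conv big_ord_recl coefXM mul0r mul0r add0r.
by apply: eq_bigr => i _; rewrite coefXM /= subSS.
Qed.

Lemma exp_convX0 p : exp_conv ('X * p) 0 = 0.
Proof. by rewrite /exp_conv big_ord_recl big_ord0 coefXM !mul0r addr0. Qed.

Lemma exp_convXn s p j :
  exp_conv ('X^s * p) j = if (s <= j)%N then exp_conv p (j - s) else 0.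
Proof.
elim: s j => [|s IH] j; first by rewrite expr0 mul1r subn0.
rewrite exprS -mulrA; case: j => [|j]; first by rewrite exp_convX0.
by rewrite exp_convXS IH.
Qed.

(** The rule (e^(mu_1 z) p)' = e^(mu_1 z) (p' + mu_1 p), read on the coefficient of z^j. *)
Lemma exp_conv_deriv p j :
  j.+1%:R * exp_conv p j.+1 = exp_conv (p^`() + mu 1 *: p) j.
Proof.
rewrite exp_convD exp_convZ /exp_conv.
rewrite mulr_sumr (eq_bigr (fun i : 'I_j.+2 =>
   i%:R * p`_i * (mu 1 ^+ (j.+1 - i) / (j.+1 - i)`!%:R) +
   (j.+1 - i)%:R * p`_i * (mu 1 ^+ (j.+1 - i) / (j.+1 - i)`!%:R))); last first.
  move=> i _; rewrite -mulrDl -mulrDl -natrD subnKC; last by rewrite -ltnS.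
  by rewrite !mulrA.
rewrite big_split /=; congr (_ + _).
  rewrite big_ord_recl mul0r mul0r add0r; apply: eq_bigr => i _.
  by rewrite coef_deriv /= subSS mulr_natl !mulrA.
rewrite big_ord_recr /= subnn !mul0r addr0 mulr_sumr; apply: eq_bigr => i _.
rewrite subSn; last by rewrite -ltnS.
rewrite factS natrM exprS; field.
by rewrite nat1r !pnatr_eq0 -lt0n fact_gt0.
Qed.

(** In degree 0 the division by [0%:R] gives 0, so this is the antiderivative that vanishes at 0. *)
Definition antideriv (p : {poly F}) : {poly F} :=
  \poly_(i < (size p).+1) (p`_i.-1 / i%:R).

Lemma coef_antideriv p i : (antideriv p)`_i = p`_i.-1 / i%:R.
Proof.
rewrite coef_poly; case: ltnP => // pi; case: i pi => [|i] pi /=.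
  by rewrite invr0 mulr0.
by rewrite nth_default ?mul0r // -ltnS.
Qed.

Lemma deriv_antideriv p : (antideriv p)^`() = p.
Proof.
apply/polyP => i; rewrite coef_deriv coef_antideriv /= -[_ *+ _]mulr_natr.
by rewrite divfK // pnatr_eq0.
Qed.

(* The polynomials u_w with
   exp(sum_(s >= 1) (-1)^(s-1) mu_s x^(s-1) z^s / s) = e^(mu_1 z) sum_w u_w(z) x^w. *)
Fixpoint upoly_seq (w : nat) : seq {poly F} :=
  if w is w'.+1 then
    let l := upoly_seq w' in
    rcons l (antideriv (\sum_(s < w'.+1)
      ((-1) ^+ s.+1 * mu s.+2) *: ('X^(s.+1) * l`_(w' - s))))
  else [:: 1].

Definition upoly w := (upoly_seq w)`_w.

Lemma size_upoly_seq w : size (upoly_seq w) = w.+1.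
Proof. by elim: w => //= w IH; rewrite size_rcons IH. Qed.

Lemma nth_upoly_seq w i : (i <= w)%N -> (upoly_seq w)`_i = upoly i.
Proof.
elim: w => [|w IH]; first by rewrite leqn0 => /eqP->.
rewrite leq_eqVlt => /orP[/eqP->//|]; rewrite ltnS => iw.
by rewrite /= nth_rcons size_upoly_seq ltnS iw IH.
Qed.

(** Differentiating the defining identity in z, the term mu_1 disappears with e^(mu_1 z) and every
    other term carries a positive power of x. Hence the derivative of u_(w+1) only involves u_0,
    ..., u_w, and u_(w+1) vanishes at 0 as the exponent does. *)
Lemma upolyS w : upoly w.+1 = antideriv (\sum_(s < w.+1)
  ((-1) ^+ s.+1 * mu s.+2) *: ('X^(s.+1) * upoly (w - s))).
Proof.
rewrite {1}/upoly /= nth_rcons size_upoly_seq ltnn eqxx; congr antideriv.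
by apply: eq_bigr => s _; rewrite nth_upoly_seq // leq_subr.
Qed.

Definition ucoef j w := exp_conv (upoly w) j.

Lemma ucoef0 w : ucoef 0 w = (w == 0%N)%:R.
Proof.
rewrite /ucoef /exp_conv big_ord_recl big_ord0 addr0 subnn expr0 fact0 mulr1 divr1.
case: w => [|w]; first by rewrite /upoly /= coef1.
by rewrite upolyS coef_antideriv invr0 mulr0.
Qed.

(** This is the recurrence that Newton's identities give for c_j x^j when N x = 1, read on the
    coefficient of x^w. The term s = 0 comes from the factor e^(mu_1 z), the others from the
    derivative of u_w. *)
Lemma ucoefS j w : j.+1%:R * ucoef j.+1 w =
  \sum_(s < w.+1 | (s <= j)%N) (-1) ^+ s * mu s.+1 * ucoef (j - s) (w - s).
Proof.
rewrite exp_conv_deriv exp_convD exp_convZ big_mkcond big_ord_recl /= expr0 mul1r !subn0.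
rewrite addrC; congr (_ + _); case: w => [|w].
  by rewrite big_ord0 /upoly /= derivC exp_conv0.
rewrite upolyS deriv_antideriv exp_conv_sum; apply: eq_bigr => s _.
rewrite exp_convZ exp_convXn /bump /= add1n subSS.
by case: ifP; rewrite ?mulr0.
Qed.

End Expansion.

(** * Bounds on the remainders *)

(* Absolute values of the Stirling numbers of the first kind:
   prod_(i < j) (1 + i x) = sum_w (rising j w) x^w. *)
Fixpoint rising (j w : nat) : nat :=
  if j is j'.+1 then
    (rising j' w + j' * (if w is w'.+1 then rising j' w' else 0))%N
  else (w == 0).

(* prod_(i < j) (1 - i x)^-1 = sum_m (complete m j) x^m. *)
Fixpoint complete (m : nat) : nat -> nat :=
  if m is m'.+1 then fun j => (\sum_(i < j) i * complete m' i.+1)%N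
  else fun=> 1%N.

(** For rising j w / j! this is the recurrence [ucoefS] without signs and with all means equal to 1;
    it reflects (1 - x z)^(-1/x) = sum_j prod_(i < j) (1 + i x) z^j / j!. *)
Lemma risingS j w : rising j.+1 w =
  (\sum_(s < w.+1 | (s <= j)%N) rising (j - s) (w - s) * j ^_ s)%N.
Proof.
elim: j w => [|j IH] w.
  by rewrite [RHS]big_mkcond big_ord_recl /= subn0 muln1 addn0 big1 ?addn0.
rewrite [RHS]big_mkcond big_ord_recl subn0 muln1; case: w => [|w].
  by rewrite big_ord0 -[LHS]/(rising j.+1 0 + j.+1 * 0)%N muln0.
rewrite -[LHS]/(rising j.+1 w.+1 + j.+1 * rising j.+1 w)%N; congr (_ + _)%N.
rewrite IH big_mkcond big_distrr; apply: eq_bigr => s _ /=.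
rewrite /bump add1n subSS subSS ffactnS ltnS; case: ifP => _; last by rewrite muln0.
by rewrite mulnCA.
Qed.

Lemma leq_expb a b w : (a <= b)%N -> (a ^ w <= b ^ w)%N.
Proof. by move=> ab; case: w => [|w]; rewrite ?expn0 // leq_exp2r. Qed.

Lemma rising_le j w : (rising j w <= (j * j) ^ w)%N.
Proof.
elim: j w => [|j IH] [|w] //=; first by rewrite muln0 addn0.
apply: (leq_trans (leq_add (IH _) (leq_mul (leqnn j) (IH _)))).
rewrite expnS -mulnDl expnS; apply: leq_mul; first lia.
by apply: leq_expb; lia.
Qed.

Lemma completeS m j : complete m.+1 j.+1 = (complete m.+1 j + j * complete m j.+1)%N.
Proof. by rewrite /= big_ord_recr. Qed.

Lemma complete_le m j : (complete m j <= (j * j) ^ m)%N.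
Proof.
elim: m j => [|m IH] j //=; rewrite expnS.
apply: (@leq_trans (\sum_(i < j) j * (j * j) ^ m)%N).
  apply: leq_sum => i _; apply: leq_mul; first exact: ltnW.
  by apply: (leq_trans (IH _)); apply: leq_expb; apply: leq_mul.
by rewrite sum_nat_const card_ord mulnA.
Qed.

Lemma sum_triangle (V : nmodType) (f : nat -> nat -> V) L :
  \sum_(l < L) \sum_(w < l.+1) f w (l - w)%N = \sum_(w < L) \sum_(m < L - w) f w m.
Proof.
elim: L => [|L IH]; first by rewrite !big_ord0.
rewrite big_ord_recr IH [RHS]big_ord_recr /= subSnn big_ord1 [in LHS]big_ord_recr /=.
rewrite subnn addrA -big_split /=; congr (_ + _); apply: eq_bigr => w _.
by rewrite subSn ?big_ord_recr // ltnW.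
Qed.

Section Remainders.
Variables (F : numFieldType) (mu : nat -> F) (rho : F).
Hypothesis rho_ge0 : 0 <= rho.
Hypothesis mu_le : forall s, `|mu s.+1| <= rho ^+ s.+1.

(** Majorant method: dropping the signs and replacing |mu_s| by rho^s turns [ucoefS] into
    [risingS]. *)
Lemma ucoef_le j w : `|ucoef mu j w| * j`!%:R <= rho ^+ j * (rising j w)%:R.
Proof.
elim/ltn_ind: j w => -[|j] IH w.
  by rewrite ucoef0 normr_nat !expr0 fact0 mulr1 mul1r.
rewrite factS natrM mulrA -[j.+1%:R]ger0_norm // -normrM [ucoef _ _ _ * _]mulrC ucoefS.
apply: (le_trans (ler_wpM2r (ler0n _ _) (ler_norm_sum _ _ _))).
rewrite mulr_suml risingS natr_sum mulr_sumr; apply: ler_sum => s sj.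
rewrite !normrM normrX normrN1 expr1n mul1r natrM.
have -> : j`! = (j ^_ s * (j - s)`!)%N by rewrite ffact_fact.
rewrite natrM.
have -> : rho ^+ j.+1 = rho ^+ s.+1 * rho ^+ (j - s) by rewrite -exprD addSn subnKC.
have := IH (j - s)%N _ (w - s)%N; rewrite ltnS leq_subr => /(_ isT) H.
have -> : `|mu s.+1| * `|ucoef mu (j - s) (w - s)| * ((j ^_ s)%:R * (j - s)`!%:R) =
   `|mu s.+1| * (j ^_ s)%:R * (`|ucoef mu (j - s) (w - s)| * (j - s)`!%:R) by ring.
have -> : rho ^+ s.+1 * rho ^+ (j - s) * ((rising (j - s) (w - s))%:R * (j ^_ s)%:R) =
   rho ^+ s.+1 * (j ^_ s)%:R * (rho ^+ (j - s) * (rising (j - s) (w - s))%:R) by ring.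
apply: ler_pM; [exact: mulr_ge0|exact: mulr_ge0|exact: ler_wpM2r|exact: H].
Qed.

Variables (N : nat) (c : nat -> F).
Hypothesis N_gt0 : (0 < N)%N.
Hypothesis c0 : c 0%N = 1.
Hypothesis newton : forall j, j.+1%:R * c j.+1 =
  \sum_(s < j.+1) (-1) ^+ s * (N%:R * mu s.+1) * c (j - s)%N.
Hypothesis c_le : forall j, `|c j| <= 'C(N, j)%:R * rho ^+ j.

Let x : F := N%:R^-1.

Let Nx : N%:R * x = 1.
Proof. by rewrite mulfV // pnatr_eq0 -lt0n. Qed.

Let x_ge0 : 0 <= x.
Proof. by rewrite invr_ge0. Qed.

Lemma natr_mulx_le j : (j <= N)%N -> j%:R * x <= 1.
Proof. by move=> jN; rewrite -[leRHS]Nx ler_wpM2r // ler_nat. Qed.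

(** Since N x = 1, both sides obey the same recurrence in j. The condition j < W passes to j - s < W
    - s, so the truncated sum is exact and leaves no remainder. *)
Lemma coef_expansion j W : (j < W)%N ->
  c j * x ^+ j = \sum_(w < W) ucoef mu j w * x ^+ w.
Proof.
elim/ltn_ind: j W => -[|j] IH W jW.
  case: W jW => // W _; rewrite big_ord_recl c0 ucoef0 !expr0 big1 ?addr0 // => i _.
  by rewrite ucoef0 mul0r.
apply: (mulfI (_ : j.+1%:R != 0)); first by rewrite pnatr_eq0.
rewrite mulrA newton mulr_suml mulr_sumr.
rewrite (eq_bigr (fun w : 'I_W => \sum_(s < W | (s <= w)%N && (s <= j)%N)
    (-1) ^+ s * mu s.+1 * ucoef mu (j - s) (w - s) * x ^+ w)); last first.
  move=> w _; rewrite mulrA ucoefS mulr_suml.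
  rewrite (big_ord_widen_cond W (fun s => (s <= j)%N) (fun s =>
    (-1) ^+ s * mu s.+1 * ucoef mu (j - s) (w - s) * x ^+ w)) //.
  by apply: eq_bigl => s; rewrite ltnS andbC.
rewrite (exchange_big_dep (fun s : 'I_W => (s <= j)%N)) /=; last by move=> w s _ /andP[].
rewrite (big_ord_widen_cond W xpredT (fun s =>
    (-1) ^+ s * (N%:R * mu s.+1) * c (j - s)%N * x ^+ j.+1)); last exact: ltnW.
rewrite big_mkcond [RHS]big_mkcond; apply: eq_bigr => s _; rewrite /= ltnS.
case: ifP => // sj.
have -> : x ^+ j.+1 = x * x ^+ s * x ^+ (j - s) by rewrite -exprS -exprD addSn subnKC.
have -> : (-1) ^+ s * (N%:R * mu s.+1) * c (j - s)%N * (x * x ^+ s * x ^+ (j - s)) =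
   (-1) ^+ s * mu s.+1 * (N%:R * x) * x ^+ s * (c (j - s)%N * x ^+ (j - s)) by ring.
rewrite Nx mulr1 (IH _ _ (W - s)%N) ?ltnS ?leq_subr //; last first.
  by apply: ltn_sub2r; [exact: leq_ltn_trans sj (ltnW jW)|exact: ltnW].
rewrite mulr_sumr (eq_bigl (fun w : 'I_W => (s <= w)%N)); last first.
  by move=> w; rewrite andbT.
rewrite -(big_mkord xpredT (fun w =>
   (-1) ^+ s * mu s.+1 * x ^+ s * (ucoef mu (j - s) w * x ^+ w))).
rewrite -[RHS](big_mkord (fun w => (s <= w)%N) (fun w =>
   (-1) ^+ s * mu s.+1 * ucoef mu (j - s) (w - s) * x ^+ w)).
transitivity (\sum_(s <= w < W)
    (-1) ^+ s * mu s.+1 * ucoef mu (j - s) (w - s) * x ^+ w).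
  rewrite [RHS](_ : _ = \sum_(0 + s <= w < W)
    (-1) ^+ s * mu s.+1 * ucoef mu (j - s) (w - s) * x ^+ w); last by rewrite add0n.
  rewrite big_addn; apply: eq_big_nat => i _.
  by rewrite addnK exprD; ring.
by rewrite (big_nat_widenl _ 0) //; apply: eq_bigl.
Qed.

(** As i x <= 1 for i < j <= N, each factor 1 + i x is at most 2, whence 2^j. Dropping the powers
    below x^L and dividing by x^L costs (j^2)^L. *)
Lemma rising_tail_le j L W : (j <= N)%N ->
  \sum_(w < W) (rising j (w + L))%:R * x ^+ w <= ((j * j) ^ L)%:R * 2 ^+ j.
Proof.
elim: j L W => [|j IH] L W jN.
  rewrite expr0 mulr1 mul0n; case: W => [|W]; first by rewrite big_ord0.
  rewrite big_ord_recl add0n expr0 mulr1 big1 ?addr0 => [|i _]; last first.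
    by rewrite lift0 addSn mul0r.
  by case: L.
have {}IH := fun L W => IH L W (ltnW jN).
case: L => [|L].
  rewrite expn0 mul1r; case: W => [|W]; first by rewrite big_ord0 exprn_ge0.
  rewrite (eq_bigr (fun w : 'I_W.+1 => (rising j w)%:R * x ^+ w +
    (j * if (w : nat) is w'.+1 then rising j w' else 0%N)%:R * x ^+ w)); last first.
    by move=> w _; rewrite addn0 /= natrD mulrDl.
  rewrite big_split /= [X in _ + X]big_ord_recl /= muln0 mul0r add0r.
  rewrite (eq_bigr (fun w : 'I_W => (j%:R * x) * ((rising j (w + 0))%:R * x ^+ w))); last first.
    by move=> w _; rewrite /bump /= add1n addn0 natrM exprS; ring.
  rewrite -mulr_sumr exprS mulr2n mulrDl mul1r.
  have H1 := IH 0%N W.+1; have H2 := IH 0%N W; rewrite expn0 mul1r in H1 H2.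
  apply: lerD; first by apply: le_trans H1; apply: ler_sum => w _; rewrite addn0.
  apply: le_trans H2; apply: ler_piMl; last exact: natr_mulx_le (ltnW jN).
  by apply: sumr_ge0 => w _; rewrite mulr_ge0 // exprn_ge0.
rewrite (eq_bigr (fun w : 'I_W => (rising j (w + L.+1))%:R * x ^+ w +
    j%:R * ((rising j (w + L))%:R * x ^+ w))); last first.
  by move=> w _; rewrite addnS /= natrD natrM mulrDl mulrA.
rewrite big_split /= -mulr_sumr.
apply: (le_trans (lerD (IH _ _) (ler_wpM2l (ler0n _ _) (IH _ _)))).
rewrite mulrA -natrM -mulrDl -natrD; apply: ler_pM; rewrite ?exprn_ge0 //.
  rewrite ler_nat expnS -mulnDl expnS; apply: leq_mul; first lia.
  by apply: leq_expb; lia.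
by rewrite exprS ler_peMl ?exprn_ge0 // ler1n.
Qed.

Lemma coef_remainder j L : (j <= N)%N ->
  `|c j * x ^+ j - \sum_(w < L) ucoef mu j w * x ^+ w| <=
  x ^+ L * ((j * j) ^ L)%:R * 2 ^+ j * rho ^+ j / j`!%:R.
Proof.
(* The expansion with j + 1 + L terms is exact and contains the L terms subtracted; the remainder is
   the finite block that follows them. *)
move=> jN; rewrite (@coef_expansion j (j.+1 + L)); last exact: leq_addr.
rewrite addnC big_split_ord /=  addrAC subrr add0r.
apply: (le_trans (ler_norm_sum _ _ _)).
rewrite ler_pdivlMr ?ltr0n ?fact_gt0 // mulr_suml.
apply: (@le_trans _ _ (\sum_(w < j.+1) x ^+ L * rho ^+ j * ((rising j (w + L))%:R * x ^+ w))).
  apply: ler_sum => w _; rewrite normrM [`|x ^+ _|]ger0_norm ?exprn_ge0 // mulrAC.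
  rewrite addnC exprD.
  have -> : x ^+ L * rho ^+ j * ((rising j (w + L))%:R * x ^+ w) =
    rho ^+ j * (rising j (w + L))%:R * (x ^+ w * x ^+ L) by ring.
  by apply: ler_wpM2r (ucoef_le _ _); rewrite mulr_ge0 ?exprn_ge0.
rewrite -mulr_sumr -!mulrA ler_wpM2l ?exprn_ge0 // mulrC mulrA.
by rewrite ler_wpM2r ?exprn_ge0 // rising_tail_le.
Qed.

(** For j <= N this is N^j (N - j)! / N! = prod_(i < j) (1 - i x)^-1. *)
Let gseq j : F := N%:R ^+ j / (N ^_ j)%:R.

Lemma gseqS j : (j < N)%N -> gseq j.+1 = gseq j + j%:R * x * gseq j.+1.
Proof.
move=> jN; rewrite /gseq ffactnSr natrM exprS natrB ?(ltnW jN) // /x.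
have N0 : N%:R != 0 :> F by rewrite pnatr_eq0 -lt0n.
have fN : (N ^_ j)%:R != 0 :> F by rewrite pnatr_eq0 -lt0n ffact_gt0 ltnW.
have Nj : N%:R - j%:R != 0 :> F by rewrite -natrB ?(ltnW jN) // pnatr_eq0 subn_eq0 -ltnNge.
by field; rewrite N0 fN Nj.
Qed.

(** Each factor 1 - i x with i < j is at least 1/2 as long as 2 j <= N, which is why the range of j
    is cut at N / 2. *)
Lemma gseq_bounds j : (j.*2 <= N)%N -> 0 <= gseq j <= 2 ^+ j.
Proof.
elim: j => [|j IH] jN; first by rewrite /gseq !expr0 ffactn0 divr1 ler01 lexx.
have jN' : (j.*2 <= N)%N by apply: leq_trans jN; rewrite leq_double.
have /andP[g0 g2] := IH jN'.
have jlt : (j < N)%N by apply: leq_trans jN; rewrite -addnn leq_addr.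
have g0' : 0 <= gseq j.+1 by rewrite divr_ge0 // exprn_ge0.
rewrite g0' exprS; have := gseqS jlt => E.
have jx : j%:R * x <= 2^-1.
  rewrite -(ler_pM2l (_ : 0 < 2)) ?ltr0n // mulfV ?pnatr_eq0 // mulrA -natrM mul2n.
  exact: natr_mulx_le.
have : gseq j.+1 <= gseq j + 2^-1 * gseq j.+1 by rewrite {1}E lerD2l ler_wpM2r.
rewrite -lerBlDr -{1}[gseq j.+1]mul1r -mulrBl.
have -> : 1 - 2^-1 = 2^-1 :> F by field.
rewrite mulrC ler_pdivrMr ?ltr0n // mulrC => H.
by apply: (le_trans H); rewrite ler_wpM2l.
Qed.

(** By [gseqS] and [completeS] the remainder satisfies R(M+1, j+1) = R(M+1, j) + j x R(M, j+1),
    hence the induction on M and then on j. *)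
Lemma gseq_remainder j M : (j.*2 <= N)%N ->
  `|gseq j - \sum_(m < M) (complete m j)%:R * x ^+ m| <=
  x ^+ M * ((j * j) ^ M)%:R * 2 ^+ j.
Proof.
elim: M j => [|M IHM] j jN.
  rewrite big_ord0 subr0 expr0 expn0 !mul1r.
  by have /andP[g0 g2] := gseq_bounds jN; rewrite ger0_norm.
elim: j jN => [|j IH] jN.
  rewrite big_ord_recl /gseq !expr0 ffactn0 divr1 mulr1 big1 => [|i _].
    by rewrite addr0 subrr normr0 mulr_ge0 // mulr_ge0 ?exprn_ge0.
  by rewrite /= big_ord0 mul0r.
have jN' : (j.*2 <= N)%N by apply: leq_trans jN; rewrite leq_double.
have jlt : (j < N)%N by apply: leq_trans jN; rewrite -addnn leq_addr.
have -> : gseq j.+1 - \sum_(m < M.+1) (complete m j.+1)%:R * x ^+ m =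
  (gseq j - \sum_(m < M.+1) (complete m j)%:R * x ^+ m) +
  j%:R * x * (gseq j.+1 - \sum_(m < M) (complete m j.+1)%:R * x ^+ m).
  have -> : \sum_(m < M.+1) (complete m j.+1)%:R * x ^+ m =
      \sum_(m < M.+1) (complete m j)%:R * x ^+ m +
      j%:R * x * \sum_(m < M) (complete m j.+1)%:R * x ^+ m.
    rewrite !big_ord_recl mulr_sumr -addrA -big_split; congr (_ + _).
    by apply: eq_bigr => m _; rewrite lift0 completeS natrD natrM exprS /=; ring.
  have -> : gseq j = gseq j.+1 - j%:R * x * gseq j.+1 
    by apply/eqP; rewrite eq_sym subr_eq -gseqS.
  ring.
apply: (le_trans (ler_normD _ _)).
apply: (le_trans (lerD (IH jN') (lexx _))).
rewrite normrM ger0_norm ?mulr_ge0 //.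
apply: (le_trans (lerD (lexx _) (ler_wpM2l (mulr_ge0 (ler0n _ _) x_ge0) (IHM _ jN)))).
have -> : j%:R * x * (x ^+ M * ((j.+1 * j.+1) ^ M)%:R * 2 ^+ j.+1) =
   x ^+ M.+1 * (j * (j.+1 * j.+1) ^ M)%:R * 2 ^+ j.+1.
  by rewrite natrM (exprS x); ring.
have H : x ^+ M.+1 * ((j * j) ^ M.+1)%:R * 2 ^+ j <=
   x ^+ M.+1 * ((j * j) * (j.+1 * j.+1) ^ M)%:R * 2 ^+ j.+1.
  apply: ler_pM; rewrite ?mulr_ge0 ?exprn_ge0 //.
    rewrite ler_wpM2l ?exprn_ge0 // ler_nat expnS leq_mul2l; apply/orP; right.
    by apply: leq_expb; lia.
  by rewrite exprS ler_peMl ?exprn_ge0 // ler1n.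
apply: (le_trans (lerD H (lexx _))); rewrite -mulrDl -mulrDr -natrD -mulnDl.
rewrite ler_wpM2r ?exprn_ge0 // ler_wpM2l ?exprn_ge0 // ler_nat expnS.
by apply: leq_mul => //; lia.
Qed.

(* Coefficient of [z^j x^l] in the expansion of F_n, where x = 1 / N. *)
Definition acoef j l := \sum_(w < l.+1) ucoef mu j w * (complete (l - w) j)%:R.

Lemma ucoef_le_pow j w : `|ucoef mu j w| <= ((j * j) ^ w)%:R * (rho ^+ j / j`!%:R).
Proof.
rewrite mulrA ler_pdivlMr ?ltr0n ?fact_gt0 //; apply: (le_trans (ucoef_le _ _)).
by rewrite mulrC ler_wpM2r ?exprn_ge0 // ler_nat rising_le.
Qed.

Lemma acoef_le j l : `|acoef j l| <= l.+1%:R * ((j * j) ^ l)%:R * (rho ^+ j / j`!%:R).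
Proof.
apply: (le_trans (ler_norm_sum _ _ _)).
have r0 : 0 <= rho ^+ j / j`!%:R by rewrite divr_ge0 // exprn_ge0.
rewrite -mulrA; apply: (@le_trans _ _ (\sum_(w < l.+1) ((j * j) ^ l)%:R * (rho ^+ j / j`!%:R))).
  apply: ler_sum => w _; rewrite normrM normr_nat.
  have -> : ((j * j) ^ l)%:R * (rho ^+ j / j`!%:R) =
     ((j * j) ^ w)%:R * (rho ^+ j / j`!%:R) * ((j * j) ^ (l - w))%:R :> F.
    by rewrite mulrAC -natrM -expnD subnKC // -ltnS.
  by apply: ler_pM => //; [exact: ucoef_le_pow|rewrite ler_nat complete_le].
by rewrite sumr_const card_ord -[leLHS]mulr_natl.
Qed.

(* Coefficient of [z^j] in F_n; it is 0 for [N < j], by division by 0. *)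
Definition vcoef j := c j / (N ^_ j)%:R.

(** The quotient of 'C(N, j) by the falling factorial [N ^_ j] is 1 / j!, so the bound does not
    depend on N. *)
Lemma vcoef_le j : `|vcoef j| <= rho ^+ j / j`!%:R.
Proof.
have [jN|jN] := leqP j N; last first.
  rewrite /vcoef ffact_small // invr0 mulr0 normr0 divr_ge0 // exprn_ge0 //.
rewrite /vcoef normrM normfV normr_nat ler_pdivrMr ?ltr0n ?ffact_gt0 //.
apply: (le_trans (c_le _)); rewrite -bin_ffact natrM mulrC.
have -> : rho ^+ j / j`!%:R * ('C(N, j)%:R * j`!%:R) = rho ^+ j * 'C(N, j)%:R.
  by field; rewrite pnatr_eq0 -lt0n fact_gt0.
by [].
Qed.

Lemma vcoef_remainder_small j L : (j.*2 <= N)%N ->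
  `|vcoef j - \sum_(l < L) acoef j l * x ^+ l| <=
  x ^+ L * ((L.+1)%:R * ((j * j) ^ L)%:R * 4 ^+ j) * (rho ^+ j / j`!%:R).
Proof.
move=> jN; have jN1 : (j <= N)%N by apply: leq_trans jN; rewrite -addnn leq_addr.
have -> : vcoef j = c j * x ^+ j * gseq j.
  by rewrite /vcoef /gseq -mulrA [x ^+ j * _]mulrA -exprMn [x * _]mulrC Nx expr1n mul1r.
(* Product of two expansions: the term of order w of the first meets the remainder of order L - w of
   the second, and the remainder of the first meets the whole second factor. This gives L + 1
   contributions, with 4^j from two bounds by 2^j. *)
have -> : c j * x ^+ j * gseq j - \sum_(l < L) acoef j l * x ^+ l =
  \sum_(w < L) ucoef mu j w * x ^+ w *
     (gseq j - \sum_(m < L - w) (complete m j)%:R * x ^+ m) +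
  (c j * x ^+ j - \sum_(w < L) ucoef mu j w * x ^+ w) * gseq j.
  have -> : \sum_(l < L) acoef j l * x ^+ l = \sum_(w < L) \sum_(m < L - w)
      ucoef mu j w * x ^+ w * ((complete m j)%:R * x ^+ m).
    rewrite -(sum_triangle (fun w m => ucoef mu j w * x ^+ w * ((complete m j)%:R * x ^+ m))).
    apply: eq_bigr => l _; rewrite mulr_suml; apply: eq_bigr => w _.
    have -> : x ^+ l = x ^+ w * x ^+ (l - w) by rewrite -exprD subnKC // -ltnS.
    ring.
  rewrite [X in _ = X + _](eq_bigr (fun w : 'I_L => ucoef mu j w * x ^+ w * gseq j -
    \sum_(m < L - w) ucoef mu j w * x ^+ w * ((complete m j)%:R * x ^+ m))).
    by rewrite sumrB -mulr_suml; ring.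
  by move=> w _; rewrite mulrBr mulr_sumr.
have /andP[g0 g2] := gseq_bounds jN.
have r0 : 0 <= rho ^+ j / j`!%:R by rewrite divr_ge0 // exprn_ge0.
have p4 : 4 ^+ j = 2 ^+ j * 2 ^+ j :> F by rewrite -exprMn -natrM.
apply: (le_trans (ler_normD _ _)).
have -> : x ^+ L * ((L.+1)%:R * ((j * j) ^ L)%:R * 4 ^+ j) * (rho ^+ j / j`!%:R) =
   \sum_(w < L) x ^+ L * ((j * j) ^ L)%:R * 4 ^+ j * (rho ^+ j / j`!%:R) +
   x ^+ L * ((j * j) ^ L)%:R * 2 ^+ j * rho ^+ j / j`!%:R * 2 ^+ j.
  by rewrite sumr_const card_ord -[_ *+ L]mulr_natl p4 -natr1; ring.
apply: lerD; last by rewrite normrM [`|gseq j|]ger0_norm // ler_pM // coef_remainder.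
apply: (le_trans (ler_norm_sum _ _ _)); apply: ler_sum => w _.
rewrite !normrM [`|x ^+ _|]ger0_norm ?exprn_ge0 //.
apply: (@le_trans _ _ (((j * j) ^ w)%:R * (rho ^+ j / j`!%:R) * x ^+ w *
    (x ^+ (L - w) * ((j * j) ^ (L - w))%:R * 2 ^+ j))).
  apply: ler_pM; rewrite ?mulr_ge0 ?exprn_ge0 //; last exact: gseq_remainder.
  by rewrite ler_wpM2r ?exprn_ge0 // ucoef_le_pow.
have -> : ((j * j) ^ w)%:R * (rho ^+ j / j`!%:R) * x ^+ w *
    (x ^+ (L - w) * ((j * j) ^ (L - w))%:R * 2 ^+ j) =
    (x ^+ w * x ^+ (L - w)) * (((j * j) ^ w)%:R * ((j * j) ^ (L - w))%:R) *
     2 ^+ j * (rho ^+ j / j`!%:R) by ring.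
have wL : (w <= L)%N := ltnW (ltn_ord w).
rewrite -exprD -natrM -expnD subnKC // ler_wpM2r // ler_wpM2l ?mulr_ge0 ?exprn_ge0 //.
by rewrite p4 ler_peMl ?exprn_ge0 // exprn_ege1 // ler1n.
Qed.

(** Here 1 <= x^L (2 j)^L, so [vcoef j] and the L terms of the sum can be bounded separately; L
    terms of size at most L and one more give L^2 + 1. *)
Lemma vcoef_remainder_large j L : (N < j.*2)%N ->
  `|vcoef j - \sum_(l < L) acoef j l * x ^+ l| <=
  x ^+ L * ((j.*2 ^ L)%:R * (L * L).+1%:R * ((j * j) ^ L)%:R) * (rho ^+ j / j`!%:R).
Proof.
move=> jN; have j0 : (0 < j)%N by case: (j) jN.
have r0 : 0 <= rho ^+ j / j`!%:R by rewrite divr_ge0 // exprn_ge0.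
have x1 : x <= 1 by rewrite invf_le1 ?ltr0n // ler1n.
have big1 : 1 <= x ^+ L * (j.*2 ^ L)%:R.
  rewrite natrX -exprMn exprn_ege1 // -[leLHS]Nx mulrC ler_wpM2l // ler_nat ltnW //.
apply: (@le_trans _ _ ((L * L).+1%:R * ((j * j) ^ L)%:R * (rho ^+ j / j`!%:R))); last first.
  rewrite [leRHS](_ : _ = (x ^+ L * (j.*2 ^ L)%:R) *
     ((L * L).+1%:R * ((j * j) ^ L)%:R * (rho ^+ j / j`!%:R))); last ring.
  by rewrite ler_peMl // mulr_ge0 // mulr_ge0.
apply: (le_trans (ler_normB _ _)).
have jj : (0 < j * j)%N by rewrite muln_gt0 j0.
rewrite -addn1 natrD mulrDl mulrDl addrC; apply: lerD.
  apply: (le_trans (ler_norm_sum _ _ _)).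
  apply: (@le_trans _ _ (\sum_(l < L) L%:R * ((j * j) ^ L)%:R * (rho ^+ j / j`!%:R))).
    apply: ler_sum => l _; rewrite normrM [`|x ^+ _|]ger0_norm ?exprn_ge0 //.
    rewrite -[leRHS]mulr1; apply: ler_pM; rewrite ?exprn_ge0 ?exprn_ile1 //.
    apply: (le_trans (acoef_le _ _)); rewrite ler_wpM2r //.
    by apply: ler_pM; rewrite ?ler_nat // leq_pexp2l // ltnW.
  by rewrite sumr_const card_ord -[_ *+ L]mulr_natl natrM !mulrA.
apply: (le_trans (vcoef_le _)); rewrite mul1r ler_peMl //.
by rewrite ler1n expn_gt0 jj.
Qed.

(** The two ranges are merged into one bound that can be summed over j: j <= 2^j turns j^(3 L) into
    (8^L)^j, the base 4 comes from small j, and the constant 2^L (L^2 + L + 1) dominates those of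
    both ranges. *)
Lemma vcoef_remainder j L :
  `|vcoef j - \sum_(l < L) acoef j l * x ^+ l| <=
  x ^+ L * (2 ^ L * (L * L + L).+1)%:R * ((4 * 8 ^ L)%:R * rho) ^+ j / j`!%:R.
Proof.
have r0 : 0 <= rho ^+ j / j`!%:R by rewrite divr_ge0 // exprn_ge0.
have j2 : (j <= 2 ^ j)%N by rewrite ltnW // ltn_expl.
have swap : ((8 ^ L) ^ j = (8 ^ j) ^ L)%N by rewrite -!expnM mulnC.
have jj8 : ((j * j) ^ L <= (8 ^ L) ^ j)%N.
  rewrite swap; apply: leq_expb; apply: (leq_trans (leq_mul j2 j2)).
  by rewrite -expnMn; apply: leq_expb.
have jjj8 : (j ^ L * (j * j) ^ L <= (8 ^ L) ^ j)%N.
  rewrite swap -expnMn; apply: leq_expb; apply: (leq_trans (leq_mul j2 (leq_mul j2 j2))).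
  by rewrite -!expnMn.
suff B (b : nat) : (b <= 2 ^ L * (L * L + L).+1 * (4 * 8 ^ L) ^ j)%N ->
  x ^+ L * b%:R * (rho ^+ j / j`!%:R) <=
  x ^+ L * (2 ^ L * (L * L + L).+1)%:R * ((4 * 8 ^ L)%:R * rho) ^+ j / j`!%:R.
  have [jN|jN] := leqP j.*2 N.
    apply: (le_trans (vcoef_remainder_small L jN)).
    rewrite -natrX -!natrM; apply: B.
    rewrite (expnMn 4) -mulnA [((j * j) ^ L * _)%N]mulnC; apply: leq_mul.
      by rewrite (leq_trans _ (leq_pmull _ _)) ?expn_gt0 // ltnS leq_addl.
    exact: leq_mul.
  apply: (le_trans (vcoef_remainder_large L jN)).
  rewrite -!natrM; apply: B.
  rewrite -mul2n (expnMn 2).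
  have -> : (2 ^ L * j ^ L * (L * L).+1 * (j * j) ^ L =
     2 ^ L * (L * L).+1 * (j ^ L * (j * j) ^ L))%N by ring.
  apply: leq_mul; first by rewrite leq_mul // ltnS leq_addr.
  by apply: (leq_trans jjj8); apply: leq_expb; rewrite leq_pmull.
move=> bb; rewrite exprMn -natrX mulrA.
have -> : x ^+ L * (2 ^ L * (L * L + L).+1)%:R * (((4 * 8 ^ L) ^ j)%:R * rho ^+ j) / j`!%:R =
  x ^+ L * (2 ^ L * (L * L + L).+1 * (4 * 8 ^ L) ^ j)%:R * (rho ^+ j / j`!%:R).
  by rewrite natrM; ring.
by rewrite -[leLHS]mulrA ler_wpM2r // ler_wpM2l ?exprn_ge0 // ler_nat.
Qed.

End Remainders.

(** * Universality of the coefficients *)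

Section Coefficients.
Variable F : numFieldType.

(** Induction on the degree: (X + 1)^(n+1) - X^(n+1) has degree n, leading coefficient n + 1 and
    telescoping sums, so a multiple of it removes the top coefficient of q. *)
Lemma poly_antidifference (q : {poly F}) : exists Q : {poly F},
  forall j, Q.[j%:R] = \sum_(i < j) q.[i%:R].
Proof.
move: (leqnn (size q)); move: {2}(size q) => n; elim: n q => [|n IH] q sq.
  exists 0 => j; rewrite horner0 big1 // => i _.
  by move: sq; rewrite leqn0 size_poly_eq0 => /eqP->; rewrite horner0.
pose D : {poly F} := \poly_(m < n.+1) 'C(n.+1, m)%:R.
have DE (i : nat) : D.[i%:R] = i.+1%:R ^+ n.+1 - i%:R ^+ n.+1.
  rewrite horner_poly -nat1r exprDn [in RHS]big_ord_recr /= subnn binn expr0 mul1r mulr1n.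
  by rewrite addrK; apply: eq_bigr => m _; rewrite expr1n mul1r mulr_natl.
pose a := q`_n / n.+1%:R.
have [|Q QE] := IH (q - a *: D).
  apply/leq_sizeP => m nm; rewrite coefB coefZ coef_poly.
  move: nm; rewrite leq_eqVlt => /orP[/eqP<-|nm].
    by rewrite ltnSn binSn /a divfK ?subrr // pnatr_eq0.
  by rewrite ltnS leqNgt nm mulr0 subr0 nth_default // (leq_trans _ nm).
exists (Q + a *: 'X^(n.+1)) => j; rewrite hornerD QE hornerZ hornerXn.
rewrite (eq_bigr (fun i : 'I_j => q.[i%:R] - a * D.[i%:R])); last first.
  by move=> i _; rewrite !hornerE.
rewrite sumrB -mulr_sumr [X in _ - a * X](eq_bigr (fun i : 'I_j => (i.+1%:R : F) ^+ n.+1 - i%:R ^+ n.+1)) => [|i _]; last exact: DE.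
have -> : \sum_(i < j) ((i.+1%:R : F) ^+ n.+1 - i%:R ^+ n.+1) = j%:R ^+ n.+1.
  rewrite -(big_mkord xpredT (fun i => (i.+1%:R : F) ^+ n.+1 - i%:R ^+ n.+1)).
  by rewrite telescope_sumr // expr0n subr0.
by rewrite subrK.
Qed.

Lemma complete_poly (m : nat) : exists q : {poly F},
  forall j, q.[j%:R] = (complete m j)%:R.
Proof.
elim: m => [|m [q qE]]; first by exists 1 => j; rewrite hornerC.
have [Q QE] := poly_antidifference ('X * (q \Po ('X + 1%:P))).
exists Q => j; rewrite QE /= natr_sum; apply: eq_bigr => i _.
by rewrite hornerM hornerX horner_comp hornerD hornerX hornerC natr1 qE natrM.
Qed.

Definition completep (m : nat) : {poly F} := projT1 (cid (complete_poly m)).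

Lemma completepE m j : (completep m).[j%:R] = (complete m j)%:R.
Proof. exact: (projT2 (cid (complete_poly m))). Qed.

Section Mean.
Variable mu : nat -> F.

(* Acts on [e^(mu_1 z) p(z)] as [z d/dz]. *)
Definition euler_op (p : {poly F}) : {poly F} := 'X * (p^`() + (mu 1)%:P * p).

(** The operator q(z d/dz) conjugated by e^(mu_1 z). *)
Definition euler_poly (q p : {poly F}) : {poly F} :=
  \sum_(i < size q) (q`_i)%:P * iter i euler_op p.

Lemma exp_conv_euler_op p j :
  exp_conv mu (euler_op p) j = j%:R * exp_conv mu p j.
Proof.
case: j => [|j]; first by rewrite mul0r exp_convX0.
by rewrite exp_convXS mul_polyC exp_conv_deriv.
Qed.

Lemma exp_conv_euler_poly q p j :
  exp_conv mu (euler_poly q p) j = q.[j%:R] * exp_conv mu p j.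
Proof.
rewrite exp_conv_sum horner_coef mulr_suml; apply: eq_bigr => i _.
rewrite mul_polyC exp_convZ -mulrA; congr (_ * _).
elim: (i : nat) => [|n IH] /=; first by rewrite mul1r.
by rewrite exp_conv_euler_op IH exprS mulrA.
Qed.

(** The case l = 0 is set apart because no mean is available there: [nb_means 0] is 0, whereas
    [euler_op] involves mu_1. *)
Definition bpoly (l : nat) : {poly F} :=
  if l is 0 then 1 else
  \sum_(w < l.+1) euler_poly (completep (l - w)) (upoly mu w).

Lemma exp_conv_bpoly l j : exp_conv mu (bpoly l) j = acoef mu j l.
Proof.
case: l => [|l]; first by rewrite /acoef big_ord_recl big_ord0 mulr1 addr0.
rewrite /bpoly exp_conv_sum; apply: eq_bigr => w _.
by rewrite exp_conv_euler_poly completepE mulrC.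
Qed.

End Mean.

(** The closure properties of this predicate follow the construction of [bpoly] step by step and
    replace an explicit formula for its coefficients. *)
Definition universal (m : nat) (Phi : (nat -> F) -> {poly F}) :=
  exists B : {poly mpoly.mpoly m F}, forall mu,
    Phi mu = map_poly (mpoly.meval (fun i : 'I_m => mu i.+1)) B.

Variable m : nat.

Lemma universal_cst p : universal m (fun=> p).
Proof.
exists (map_poly (@mpoly.mpolyC m F) p) => mu.
by apply/polyP => i; rewrite !coef_map /= mpoly.mevalC.
Qed.

Lemma universal_mu s : (s < m)%N -> universal m (fun mu => (mu s.+1)%:P).
Proof.
move=> sm; exists (mpoly.mpolyX F (mpoly.mnm1 (Ordinal sm)))%:P => mu.
by rewrite map_polyC /= mpoly.mevalXU.
Qed.

Lemma universalD Phi Psi : universal m Phi -> universal m Psi ->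
  universal m (fun mu => Phi mu + Psi mu).
Proof.
by move=> [B BE] [B' BE']; exists (B + B') => mu; rewrite rmorphD /= BE BE'.
Qed.

Lemma universalM Phi Psi : universal m Phi -> universal m Psi ->
  universal m (fun mu => Phi mu * Psi mu).
Proof.
by move=> [B BE] [B' BE']; exists (B * B') => mu; rewrite rmorphM /= BE BE'.
Qed.

Lemma universal_sum n (Phi : nat -> (nat -> F) -> {poly F}) :
  (forall i, (i < n)%N -> universal m (Phi i)) ->
  universal m (fun mu => \sum_(i < n) Phi i mu).
Proof.
elim: n => [|n IH] PhiU.
  rewrite (_ : (fun mu => _) = fun=> 0); first exact: universal_cst.
  by apply/funext => mu; rewrite big_ord0.
rewrite (_ : (fun mu => _) = fun mu => \sum_(i < n) Phi i mu + Phi n mu); last first.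
  by apply/funext => mu; rewrite big_ord_recr.
by apply: universalD; [apply: IH => i /ltnW; exact: PhiU|exact: PhiU].
Qed.

Lemma universal_deriv Phi : universal m Phi -> universal m (fun mu => (Phi mu)^`()).
Proof. by move=> [B BE]; exists B^`() => mu; rewrite BE deriv_map. Qed.

Lemma universal_antideriv Phi : universal m Phi ->
  universal m (fun mu => antideriv (Phi mu)).
Proof.
move=> [B BE].
exists (\poly_(i < (size B).+1) (mpoly.mpolyC m (i%:R^-1) * B`_i.-1)) => mu.
apply/polyP => i; rewrite coef_antideriv BE !coef_map coef_poly.
set v := fun i : 'I_m => mu i.+1; case: ltnP => Bi.
  by rewrite [RHS](mpoly.mevalM v) mpoly.mevalC mulrC.
rewrite [RHS](mpoly.meval0 v); case: i Bi => [//|i] Bi /=.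
by rewrite nth_default ?raddf0 ?mul0r.
Qed.

(** The mean of largest index in the recursion for u_w is mu_(w+1), whence the strict inequality. *)
Lemma universal_upoly w : (w < m)%N -> universal m (fun mu => upoly mu w).
Proof.
elim/ltn_ind: w => -[|w] IH wm; first exact: universal_cst.
rewrite (_ : (fun mu => _) = fun mu => antideriv (\sum_(s < w.+1)
    (((-1) ^+ s.+1)%:P * (mu s.+2)%:P) * ('X^(s.+1) * upoly mu (w - s)))); last first.
  apply/funext => mu; rewrite upolyS; congr antideriv; apply: eq_bigr => s _.
  by rewrite -polyCM mul_polyC.
apply: universal_antideriv.
apply: (@universal_sum _ (fun s mu =>
  (((-1) ^+ s.+1)%:P * (mu s.+2)%:P) * ('X^(s.+1) * upoly mu (w - s)))) => s sw.
apply: universalM; apply: universalM; try exact: universal_cst.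
  by apply: universal_mu; apply: leq_ltn_trans wm.
by apply: IH; [rewrite ltnS leq_subr|apply: leq_ltn_trans (leq_subr _ _) (ltnW wm)].
Qed.

Lemma universal_euler_poly q Phi : (0 < m)%N -> universal m Phi ->
  universal m (fun mu => euler_poly mu q (Phi mu)).
Proof.
move=> m0 PhiU; apply: (@universal_sum _ (fun i mu =>
  (q`_i)%:P * iter i (euler_op mu) (Phi mu))) => i _.
apply: universalM; first exact: universal_cst.
elim: i => [//|i IH] /=; apply: universalM; first exact: universal_cst.
apply: universalD; first exact: universal_deriv.
by apply: universalM => //; exact: universal_mu.
Qed.

End Coefficients.

(** * Complex derivatives *)

Section Modulus.
Local Open Scope classical_set_scope.
Local Open Scope ring_scope.
Local Open Scope complex_scope.
Variable R : realType.
Implicit Types (x y z : R[i]) (a b : R).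

Lemma normr_normc z : `|z| = (normc z)%:C.
Proof. by case: z. Qed.

Lemma normcDE z x : normc (z + x) <= normc z + normc x.
Proof. exact: (@le_normcD R). Qed.

Lemma normcNE z : normc (- z) = normc z.
Proof. exact: (@normcN R). Qed.

Lemma normc_ge0 z : 0 <= normc z.
Proof. by case: z => a b; rewrite sqrtr_ge0. Qed.

Lemma normc_distC x y : normc (x - y) = normc (y - x).
Proof. by rewrite -normcNE opprB. Qed.

Lemma normc_sqr z : normc z ^+ 2 = complex.Re z ^+ 2 + complex.Im z ^+ 2.
Proof. by case: z => a b; rewrite sqr_sqrtr // addr_ge0 ?sqr_ge0. Qed.

Lemma normc_real a : normc a%:C = `|a|.
Proof. by rewrite /normc /= expr0n /= addr0 sqrtr_sqr. Qed.

Lemma normc_imag a : normc (0 +i* a) = `|a|.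
Proof. by rewrite /normc /= expr0n /= add0r sqrtr_sqr. Qed.

Lemma normcX z n : normc (z ^+ n) = normc z ^+ n.
Proof.
elim: n => [|n IH]; first by rewrite !expr0 normc1.
by rewrite !exprS normcM IH.
Qed.

Lemma normc_nat n : normc (n%:R : R[i]) = n%:R.
Proof. by have := @normr_nat R[i] n; rewrite normr_normc -(rmorph_nat (real_complex R)) => /complexI. Qed.

Lemma normc_gt0 z : (0 < normc z) = (z != 0).
Proof.
rewrite lt_def normc_ge0 andbT; congr negb; apply/eqP/eqP => [/eq0_normc//|->].
exact: normc0.
Qed.

Lemma Re_le_normc z : `|complex.Re z| <= normc z.
Proof. by have := normc_ge_Re z; rewrite normr_normc lecR. Qed.

Lemma Im_le_normc z : `|complex.Im z| <= normc z.
Proof.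
rewrite -ler_sqr ?nnegrE ?normc_ge0 // normc_sqr real_normK ?num_real //.
by rewrite lerDr sqr_ge0.
Qed.

Lemma normc_le_ReIm z : normc z <= `|complex.Re z| + `|complex.Im z|.
Proof.
rewrite -ler_sqr ?nnegrE ?normc_ge0 ?addr_ge0 // normc_sqr sqrrD.
rewrite !real_normK ?num_real //; have := normr_ge0 (complex.Re z).
have := normr_ge0 (complex.Im z); nra.
Qed.

Lemma ReM_real a z : complex.Re (a%:C * z) = a * complex.Re z.
Proof. by case: z => c d /=; rewrite mul0r subr0. Qed.

Lemma ImM_real a z : complex.Im (a%:C * z) = a * complex.Im z.
Proof. by case: z => c d /=; rewrite mul0r addr0. Qed.

Lemma ReB x y : complex.Re (x - y) = complex.Re x - complex.Re y.
Proof. by case: x; case: y. Qed.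

Lemma ImB x y : complex.Im (x - y) = complex.Im x - complex.Im y.
Proof. by case: x; case: y. Qed.

Lemma ReD x y : complex.Re (x + y) = complex.Re x + complex.Re y.
Proof. by case: x; case: y. Qed.

Lemma ImD x y : complex.Im (x + y) = complex.Im x + complex.Im y.
Proof. by case: x; case: y. Qed.

End Modulus.

Section Derivatives.
Local Open Scope classical_set_scope.
Local Open Scope ring_scope.
Local Open Scope complex_scope.
Variable R : realType.
Local Notation C := R[i].
Implicit Types (f g : C -> C) (p q : R -> C).

(** A first-order bound in the real-valued [normc], which restricts directly to real paths, as in
    [rderiv], and to real and imaginary parts. *)
Definition cderiv f (z l : C) := forall e : R, 0 < e -> exists2 d : R, 0 < d &
  forall h, normc h < d -> normc (f (z + h) - f z - l * h) <= e * normc h.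

Definition rderiv p (t : R) (l : C) := forall e : R, 0 < e ->
  exists2 d : R, 0 < d &
  forall k, `|k| < d -> normc (p (t + k) - p t - l * k%:C) <= e * `|k|.

Lemma entire_cderiv f : entire f -> forall z, exists l, cderiv f z l.
Proof.
move=> fE z; have /cvg_ex[/= l fl] := fE z; exists l => e e0.
have e0' : 0 < e%:C :> R[i] by rewrite ltcR.
move/cvgrPdist_le: fl => /(_ _ e0'); rewrite near_withinE => /nbhs_ballP[d /= d0 dP].
have dr : d = (complex.Re d)%:C by rewrite RRe_real // gtr0_real.
exists (complex.Re d) => [|h hd]; first by rewrite -ltcR -dr.
have [->|h0] := eqVneq h 0.
  by rewrite addr0 subrr mulr0 subrr normc0 mulr0.
have /dP/(_ h0) : ball (0 : R[i]^o) d h.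
  by rewrite /ball/= sub0r normrN normr_normc dr ltcR.
rewrite normr_normc lecR => H.
have -> : f (z + h) - f z - l * h = - h * (l - h^-1 *: ((f (h%:A + z) - f z) : R[i]^o)).
  rewrite [h%:A]mulr1 [z + h]addrC -[_ *: _]/(_ * _); by field.
by rewrite normcM normcNE mulrC ler_wpM2r // normc_ge0.
Qed.

Lemma rderiv_is_derive (u : R -> R) (t l : R) :
  (forall e : R, 0 < e -> exists2 d : R, 0 < d &
    forall k, `|k| < d -> `|u (t + k) - u t - l * k| <= e * `|k|) ->
  is_derive t 1 u l.
Proof.
move=> H.
suff cv : h^-1 *: (u (h%:A + t) - u t) @[h --> 0^'] --> l.
  apply: DeriveDef; first by apply/cvg_ex; exists l.
  by apply/cvg_lim.
apply/cvgrPdist_le => e e0; have [d d0 dP] := H e e0.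
rewrite near_withinE; apply/nbhs_ballP; exists d => //= h.
rewrite /ball/= sub0r normrN => hd h0.
have -> : l - h^-1 *: (u (h%:A + t) - u t) = - (h^-1 * (u (t + h) - u t - l * h)).
  rewrite [h%:A]mulr1 [h + t]addrC /GRing.scale /=; by field.
rewrite normrN normrM normfV mulrC ler_pdivrMr ?normr_gt0 //.
exact: dP.
Qed.

Lemma is_derive_rderiv (u : R -> R) (t l : R) : is_derive t 1 u l ->
  forall e : R, 0 < e -> exists2 d : R, 0 < d &
    forall k, `|k| < d -> `|u (t + k) - u t - l * k| <= e * `|k|.
Proof.
move=> [/cvg_ex[/= m ul] lE] e e0.
have {}lE : m = l by rewrite -lE; apply/esym/cvg_lim.
move: ul => /cvgrPdist_le/(_ _ e0).
rewrite near_withinE => /nbhs_ballP[d /= d0 dP].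
exists d => // h hd; have [->|h0] := eqVneq h 0.
  by rewrite addr0 subrr mulr0 subrr normr0 mulr0.
have /dP/(_ h0) : ball 0 d h by rewrite /ball/= sub0r normrN.
move=> H; have -> : u (t + h) - u t - l * h = - h * (m - h^-1 *: (u (h%:A + t) - u t)).
  by rewrite lE [h%:A]mulr1 [h + t]addrC /GRing.scale /=; field.
by rewrite normrM normrN mulrC ler_wpM2r.
Qed.

Lemma rderiv_Re_is_derive (c : C) p t l : rderiv p t l ->
  is_derive t 1 (fun s => complex.Re (c * p s)) (complex.Re (c * l)).
Proof.
move=> H; apply: rderiv_is_derive => e e0.
have c1 : 0 < normc c + 1 by rewrite ltr_pwDr // normc_ge0.
have [d d0 dP] := H (e / (normc c + 1)) (divr_gt0 e0 c1).
exists d => // k kd.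
have -> : complex.Re (c * p (t + k)) - complex.Re (c * p t) - complex.Re (c * l) * k
          = complex.Re (c * (p (t + k) - p t - l * k%:C)).
  rewrite [_ * k]mulrC -ReM_real -!ReB; congr complex.Re; ring.
apply: (le_trans (Re_le_normc _)); rewrite normcM.
apply: (@le_trans _ _ ((normc c + 1) * normc (p (t + k) - p t - l * k%:C))).
  by rewrite ler_wpM2r ?normc_ge0 // lerDl.
by rewrite mulrC -ler_pdivlMr // mulrAC dP.
Qed.

Lemma is_derive_continuous (u : R -> R) (t l : R) : is_derive t 1 u l ->
  {for t, continuous u}.
Proof. by move=> [ud _]; apply/differentiable_continuous/derivable1_diffP. Qed.

Lemma rderiv_components p (t : R) (l : C) :
  is_derive t 1 (fun s : R => complex.Re (p s)) (complex.Re l) ->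
  is_derive t 1 (fun s : R => complex.Im (p s)) (complex.Im l) -> rderiv p t l.
Proof.
move=> pR pI e e0; have e20 : 0 < e / 2 by rewrite divr_gt0.
have [d1 d10 P1] := is_derive_rderiv pR e20.
have [d2 d20 P2] := is_derive_rderiv pI e20.
exists (Num.min d1 d2); first by rewrite lt_min d10.
move=> k; rewrite lt_min => /andP[k1 k2].
apply: (le_trans (normc_le_ReIm _)).
have -> : e * `|k| = e / 2 * `|k| + e / 2 * `|k| by field.
rewrite [l * _]mulrC !ReB !ImB ReM_real ImM_real ![k * _]mulrC.
by apply: lerD; [exact: P1|exact: P2].
Qed.

(** A complex function has no mean value theorem; the real one is applied to Re (conj(c) p) - |c| h
    with c = p b - p a, whose increment is |c| (|c| - (h b - h a)). *)
Lemma rderiv_majorant p (dp : R -> C) (h dh : R -> R) (a b : R) : a <= b ->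
  (forall t, a <= t <= b -> rderiv p t (dp t)) ->
  (forall t : R, a <= t <= b -> is_derive t 1 h (dh t)) ->
  (forall t, a <= t <= b -> normc (dp t) <= dh t) ->
  normc (p b - p a) <= h b - h a.
Proof.
move=> ab pD hD dM; set c := p b - p a.
pose u s := complex.Re (c^* * p s) - normc c * h s.
have uD s : a <= s <= b ->
    is_derive s 1 u (complex.Re (c^* * dp s) - normc c * dh s).
  move=> sI; have H1 := rderiv_Re_is_derive (c^*) (pD s sI); have H2 := hD s sI.
  rewrite (_ : u = (fun s => complex.Re (c^* * p s)) - normc c *: (h : R -> R^o)) //.
  exact: is_deriveB.
have [s sI us] : exists2 s, s \in `[a, b] &
    u b - u a = (complex.Re (c^* * dp s) - normc c * dh s) * (b - a).
  apply: (MVT_segment ab).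
    by move=> s /itvP sI; apply: uD; rewrite !sI.
  apply/continuous_in_subspaceT => s; rewrite inE /= in_itv /= => sI.
  exact: is_derive_continuous (uD s sI).
have sab : a <= s <= b by move: sI; rewrite in_itv.
have u0 : u b - u a <= 0.
  rewrite us mulr_le0_ge0 ?subr_ge0 // subr_le0; apply: (le_trans (ler_norm _)).
  apply: (le_trans (Re_le_normc _)); rewrite normcM.
  have -> : normc c^* = normc c.
    by have := @normcJ R c; rewrite !normr_normc => /complexI.
  by rewrite ler_wpM2l ?normc_ge0 // dM.
have uE : u b - u a = normc c * (normc c - (h b - h a)).
  have -> : u b - u a = (complex.Re (c^* * p b) - complex.Re (c^* * p a)) -
      normc c * (h b - h a) by rewrite /u; ring.
  rewrite -ReB -mulrBr -/c [RHS]mulrBr -expr2 normc_sqr; congr (_ - _).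
  by case: (c) => x y /=; ring.
(* For c = 0 one cannot divide by |c|; the claim is then h a <= h b, which follows from dh >= |dp|
   >= 0. *)
have [->|c0] := eqVneq c 0; last first.
  by rewrite -subr_le0 -(pmulr_rle0 _ (_ : 0 < normc c)) ?normc_gt0 // -uE.
rewrite normc0.
have [r rI hE] : exists2 r, r \in `[a, b] & h b - h a = dh r * (b - a).
  apply: (MVT_segment ab).
    by move=> r /itvP rI; apply: hD; rewrite !rI.
  apply/continuous_in_subspaceT => r; rewrite inE /= in_itv /= => rI.
  exact: is_derive_continuous (hD r rI).
have rab : a <= r <= b by move: rI; rewrite in_itv.
by rewrite hE mulr_ge0 ?subr_ge0 // (le_trans (normc_ge0 _) (dM _ rab)).
Qed.

Lemma rderiv_mean_value p (dp : R -> C) (a b M : R) : a <= b ->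
  (forall t, a <= t <= b -> rderiv p t (dp t)) ->
  (forall t, a <= t <= b -> normc (dp t) <= M) ->
  normc (p b - p a) <= M * (b - a).
Proof.
move=> ab pD dM; rewrite mulrBr.
apply: (rderiv_majorant (dh := fun=> M) ab pD) => // t _.
apply: rderiv_is_derive => e e0; exists 1 => // k _.
by rewrite -mulrBr addrAC subrr add0r subrr normr0 mulr_ge0 // ltW.
Qed.

Lemma rderiv_mean_value_sym p (dp : R -> C) (a b M : R) :
  (forall t, Num.min a b <= t <= Num.max a b -> rderiv p t (dp t)) ->
  (forall t, Num.min a b <= t <= Num.max a b -> normc (dp t) <= M) ->
  normc (p b - p a) <= M * `|b - a|.
Proof.
have [ab|/ltW ba] := leP a b => pD dM.
  rewrite ger0_norm ?subr_ge0 //; exact: rderiv_mean_value pD dM.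
rewrite normc_distC distrC ger0_norm ?subr_ge0 //.
exact: rderiv_mean_value pD dM.
Qed.

Lemma rderivB p q t l m : rderiv p t l -> rderiv q t m ->
  rderiv (fun s => p s - q s) t (l - m).
Proof.
move=> pD qD e e0; have e20 : 0 < e / 2 by rewrite divr_gt0.
have [d1 d10 P1] := pD _ e20; have [d2 d20 P2] := qD _ e20.
exists (Num.min d1 d2); first by rewrite lt_min d10.
move=> k; rewrite lt_min => /andP[k1 k2].
have -> : p (t + k) - q (t + k) - (p t - q t) - (l - m) * k%:C =
   (p (t + k) - p t - l * k%:C) + - (q (t + k) - q t - m * k%:C) by ring.
apply: (le_trans (normcDE _ _)); rewrite normcNE.
apply: (le_trans (lerD (P1 _ k1) (P2 _ k2))); rewrite -mulrDl ler_wpM2r //; lra.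
Qed.

Lemma rderivD p q t l m : rderiv p t l -> rderiv q t m ->
  rderiv (fun s => p s + q s) t (l + m).
Proof.
move=> pD qD; have qN : rderiv (fun s => - q s) t (- m).
  move=> e /qD[d d0 dP]; exists d => // k /dP.
  by rewrite -normcNE; congr (normc _ <= _); ring.
have := rderivB pD qN; congr rderiv; last by rewrite opprK.
by apply/funext => s; rewrite opprK.
Qed.

Lemma is_derive_rderivM (u : R -> R) (t l : R) (c : C) : is_derive t 1 u l ->
  rderiv (fun s => (u s)%:C * c) t (l%:C * c).
Proof.
move=> uD e e0; have c1 : 0 < normc c + 1 by rewrite ltr_pwDr // normc_ge0.
have [d d0 dP] := is_derive_rderiv uD (divr_gt0 e0 c1).
exists d => // k /dP kd.
have -> : (u (t + k))%:C * c - (u t)%:C * c - l%:C * c * k%:C =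
    (u (t + k) - u t - l * k)%:C * c by rewrite !rmorphB rmorphM /=; ring.
rewrite normcM normc_real; move: kd; rewrite mulrAC ler_pdivlMr //.
by apply: le_trans; rewrite ler_wpM2l // lerDl.
Qed.

Lemma cderiv_line f a w t l : cderiv f (a + t%:C * w) l ->
  rderiv (fun s => f (a + s%:C * w)) t (l * w).
Proof.
move=> fD e e0; have w1 : 0 < normc w + 1 by rewrite ltr_pwDr // normc_ge0.
have [d d0 dP] := fD (e / (normc w + 1)) (divr_gt0 e0 w1).
exists (d / (normc w + 1)); first exact: divr_gt0.
move=> k; rewrite ltr_pdivlMr // => kd.
have -> : a + (t + k)%:C * w = a + t%:C * w + k%:C * w by rewrite rmorphD /=; ring.
have kw : normc (k%:C * w) <= `|k| * (normc w + 1).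
  by rewrite normcM normc_real ler_wpM2l // lerDl.
have := dP _ (le_lt_trans kw kd).
have -> : l * (k%:C * w) = l * w * k%:C by ring.
move=> H; apply: (le_trans H).
rewrite mulrAC ler_pdivrMr // -mulrA ler_wpM2l ?(ltW e0) //.
Qed.

Lemma cderivB f g z l m : cderiv f z l -> cderiv g z m ->
  cderiv (fun w => f w - g w) z (l - m).
Proof.
move=> fD gD e e0; have e20 : 0 < e / 2 by rewrite divr_gt0.
have [d1 d10 P1] := fD _ e20; have [d2 d20 P2] := gD _ e20.
exists (Num.min d1 d2); first by rewrite lt_min d10.
move=> k; rewrite lt_min => /andP[k1 k2].
have -> : f (z + k) - g (z + k) - (f z - g z) - (l - m) * k =
   (f (z + k) - f z - l * k) + - (g (z + k) - g z - m * k) by ring.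
apply: (le_trans (normcDE _ _)); rewrite normcNE.
apply: (le_trans (lerD (P1 _ k1) (P2 _ k2))); rewrite -mulrDl ler_wpM2r ?normc_ge0 //; lra.
Qed.

Lemma cderiv_continuous f z l : cderiv f z l ->
  forall e : R, 0 < e -> exists2 d : R, 0 < d &
  forall h, normc h < d -> normc (f (z + h) - f z) <= e.
Proof.
move=> fD e e0; have [d d0 dP] := fD 1 ltr01.
have l1 : 0 < normc l + 1 by rewrite ltr_pwDr // normc_ge0.
exists (Num.min d (e / (normc l + 1))); first by rewrite lt_min d0 divr_gt0.
move=> h; rewrite lt_min ltr_pdivlMr // => /andP[hd he].
have -> : f (z + h) - f z = (f (z + h) - f z - l * h) + l * h by ring.
apply: (le_trans (normcDE _ _)); apply: (le_trans (lerD (dP _ hd) (lexx _))).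
by rewrite normcM -mulrDl [1 + _]addrC mulrC ltW.
Qed.

(** The integral from a has the right derivative only at points t > a. The base point -(|x| + 1)
    lies below both x and 0, and subtracting the integral up to 0 makes the result independent of
    it, which is [UE]. *)
Lemma continuous_primitive (u : R -> R) : continuous u ->
  exists U : R -> R, forall t : R, is_derive t 1 U (u t).
Proof.
move=> uC.
pose G a x := (\int[lebesgue_measure]_(t in `[a, x]) u t)%R.
have uI a b : lebesgue_measure.-integrable `[a, b] (EFin \o u).
  apply: continuous_compact_integrable; first exact: segment_compact.
  exact: continuous_subspaceT.
have GD a (t : R) : a < t -> is_derive t 1 (G a) (u t).
  move=> at_; have [] := @continuous_FTC1 R u (BLeft a) t (t + 1) _ (uI _ _) _ (uC t).
  - by rewrite ltrDl.
  - by [].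
  by move=> GD <-; rewrite derive1E; apply: DeriveDef.
pose lo (x : R) := - (`|x| + 1).
pose U x := G (lo x) x - G (lo x) 0.
have UE a x : a < 0 -> a < x -> U x = G a x - G a 0.
  have cmp b c : b <= c -> c < 0 -> c < x -> G c x - G c 0 = G b x - G b 0.
    move=> bc c0 cx; have spl y : c < y -> G b y = G b c + G c y.
      move=> cy; rewrite /G.
      have oc : lebesgue_measure.-integrable `]c, y] (EFin \o u).
        by apply: integrableS (uI c y) => //; exact: subset_itv_oc_cc.
      rewrite -(Rintegral_itv_obnd_cbnd oc).
      rewrite -(@Rintegral_itvB _ u (BLeft b) (BRight y) c (uI _ _)) ?bnd_simp ?(ltW cy) //.
      by rewrite addrC subrK.
    by rewrite (spl x) // (spl 0) //; ring.
  move=> a0 ax; rewrite /U.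
  have lo0 : lo x < 0 by rewrite oppr_lt0 ltr_pwDr.
  have lox : lo x < x by rewrite /lo ltrNl; have := ler_norm (- x); rewrite normrN; lra.
  by have [al|/ltW la] := leP a (lo x); [apply: cmp|rewrite -(cmp (lo x) a)].
exists U => t; apply: rderiv_is_derive => e e0.
have lt_ : - (`|t| + 1) < t by rewrite ltrNl; have := ler_norm (- t); rewrite normrN; lra.
have l0 : - (`|t| + 1) < 0 by rewrite oppr_lt0 ltr_pwDr.
have [d d0 dP] := is_derive_rderiv (GD _ _ lt_) e0.
exists (Num.min d (t + (`|t| + 1))); first by rewrite lt_min d0; lra.
move=> k; rewrite lt_min => /andP[kd kt].
have kt' : - (`|t| + 1) < t + k by move: kt; rewrite ltr_norml; lra.
rewrite (UE _ _ l0 lt_) (UE _ _ l0 kt').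
have -> : forall x y z : R, x - z - (y - z) = x - y by move=> x y z; ring.
exact: dP.
Qed.

End Derivatives.

(** * Goursat's lemma and the identity theorem *)

Section Goursat.
Local Open Scope classical_set_scope.
Local Open Scope ring_scope.
Local Open Scope complex_scope.
Variable R : realType.
Local Notation C := R[i].

Lemma rderiv_primitive (p : R -> C) :
  (forall (t e : R), 0 < e -> exists2 d : R, 0 < d &
    forall k, `|k| < d -> normc (p (t + k) - p t) <= e) ->
  exists P, forall t, rderiv P t (p t).
Proof.
move=> pC.
have part (r : C -> R) : (forall x y, r (x - y) = r x - r y) ->
    (forall x, `|r x| <= normc x) ->
    exists U : R -> R, forall t : R, is_derive t 1 U (r (p t)).
  move=> rB rn; apply: continuous_primitive => t.
  apply/cvgrPdist_le => e e0; have [d d0 dP] := pC t e e0.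
  apply/nbhs_ballP; exists d => //= s; rewrite /ball/= distrC => st.
  rewrite distrC -rB; apply: (le_trans (rn _)).
  by have := dP _ st; rewrite [t + _]addrC subrK.
have [U UD] := part (@complex.Re R) (@ReB R) (@Re_le_normc R).
have [V VD] := part (@complex.Im R) (@ImB R) (@Im_le_normc R).
by exists (fun t => U t +i* V t) => t; apply: rderiv_components.
Qed.

Lemma nested_intervals (x : nat -> R) (w : R) : 0 <= w ->
  (forall n, x n <= x n.+1 /\ x n.+1 + w / 2 ^+ n.+1 <= x n + w / 2 ^+ n) ->
  exists y, forall n, x n <= y <= x n + w / 2 ^+ n.
Proof.
move=> w0 H.
have wn n : 0 <= w / 2 ^+ n by rewrite divr_ge0 // exprn_ge0.
have incr m n : x m <= x (m + n)%N.
  elim: n => [|n IH]; first by rewrite addn0.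
  by rewrite addnS (le_trans IH) //; case: (H (m + n)%N).
have decr m n : x (m + n)%N + w / 2 ^+ (m + n) <= x m + w / 2 ^+ m.
  elim: n => [|n IH]; first by rewrite addn0.
  by rewrite addnS (le_trans _ IH) //; case: (H (m + n)%N).
have ub m n : x m <= x n + w / 2 ^+ n.
  apply: (le_trans (incr m n)).
  by apply: (le_trans _ (decr n m)); rewrite addnC lerDl.
have hs : has_sup (range x).
  split; first by exists (x 0%N), 0%N.
  by exists (x 0%N + w / 2 ^+ 0) => _ [n _ <-].
exists (sup (range x)) => n; apply/andP; split.
  by apply: (sup_upper_bound hs); exists n.
by apply: ge_sup; [exists (x 0%N), 0%N|move=> _ [m _ <-]].
Qed.

Lemma half_pow_lt (c d : R) : 0 < d -> exists n, c / 2 ^+ n < d.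
Proof.
move=> d0; exists (Num.bound (`|c| / d)).
rewrite ltr_pdivrMr ?exprn_gt0 // mulrC -ltr_pdivrMr //.
apply: (le_lt_trans (_ : _ <= `|c| / d)).
  by rewrite ler_wpM2r ?invr_ge0 ?(ltW d0) ?ler_norm.
apply: (lt_le_trans (archi_boundP _)); first by rewrite divr_ge0 // ltW.
by rewrite -natrX ler_nat ltnW // ltn_expl.
Qed.

Variables (f f' : C -> C) (H V : R -> R -> C).
Hypothesis f_deriv : forall z, cderiv f z (f' z).
Hypothesis H_deriv : forall y t, rderiv (H y) t (f (t +i* y)).
Hypothesis V_deriv : forall x t, rderiv (V x) t (f (x +i* t) * 'i).

(* The integral of [f] along the boundary of the rectangle [a, b] x [c, d], the
   integrals along the sides being expressed with primitives. *)
Definition boundary a b c d :=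
  (H c b - H c a) + (V b d - V b c) - (H d b - H d a) - (V a d - V a c).

(** The boundary integral is the sum of those of the four quarters, whose common sides cancel; one
    of them carries at least a fourth of the modulus. *)
Lemma boundary_quarter a c p q : exists a' c',
  [/\ a' = a \/ a' = a + p / 2, c' = c \/ c' = c + q / 2 &
   normc (boundary a (a + p) c (c + q)) <=
   4 * normc (boundary a' (a' + p / 2) c' (c' + q / 2))].
Proof.
have hp x (r : R) : x + r / 2 + r / 2 = x + r by field.
have E : boundary a (a + p) c (c + q) =
   boundary a (a + p / 2) c (c + q / 2) +
   boundary (a + p / 2) (a + p / 2 + p / 2) c (c + q / 2) +
   boundary a (a + p / 2) (c + q / 2) (c + q / 2 + q / 2) +
   boundary (a + p / 2) (a + p / 2 + p / 2) (c + q / 2) (c + q / 2 + q / 2).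
  by rewrite /boundary !hp; ring.
set W := boundary a (a + p) c (c + q) in E *.
set w1 := boundary a _ c _ in E; set w2 := boundary _ _ c _ in E.
set w3 := boundary a _ _ _ in E; set w4 := boundary _ _ _ _ in E.
have HW : normc W <= normc w1 + normc w2 + normc w3 + normc w4.
  rewrite E; apply: (le_trans (normcDE _ _)); rewrite lerD2r.
  by apply: (le_trans (normcDE _ _)); rewrite lerD2r normcDE.
have [h1|h1] := leP (normc W) (4 * normc w1).
  by exists a, c; split; [left|left|].
have [h2|h2] := leP (normc W) (4 * normc w2).
  by exists (a + p / 2), c; split; [right|left|].
have [h3|h3] := leP (normc W) (4 * normc w3).
  by exists a, (c + q / 2); split; [left|right|].
exists (a + p / 2), (c + q / 2); split; [by right|by right|].
by rewrite -/w4; lra.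
Qed.

(** The affine approximation of f at z has the primitive P, whose contributions cancel around the
    rectangle; the error e is left, times the perimeter. *)
Lemma boundary_small (z : C) a b c d e : a <= b -> c <= d ->
  (forall x y, a <= x <= b -> c <= y <= d ->
    normc (f (x +i* y) - f z - f' z * (x +i* y - z)) <= e) ->
  normc (boundary a b c d) <= 2 * e * ((b - a) + (d - c)).
Proof.
move=> ab cd small.
pose P w := f z * (w - z) + f' z * (w - z) ^+ 2 / 2.
have PD w : cderiv P w (f z + f' z * (w - z)).
  move=> r r0; have l1 : 0 < normc (f' z / 2) + 1 by rewrite ltr_pwDr // normc_ge0.
  exists (r / (normc (f' z / 2) + 1)); first exact: divr_gt0.
  move=> h; rewrite ltr_pdivlMr // => hr.
  have -> : P (w + h) - P w - (f z + f' z * (w - z)) * h = (f' z / 2 * h) * h.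
    by rewrite /P; field.
  rewrite normcM ler_wpM2r ?normc_ge0 // normcM; apply: le_trans (ltW hr).
  by rewrite mulrC ler_wpM2l ?normc_ge0 // lerDl.
have hor y : c <= y <= d ->
   normc ((H y b - H y a) - (P (b +i* y) - P (a +i* y))) <= e * (b - a).
  move=> cy; pose p t := H y t - P ((0 +i* y) + t%:C * 1).
  have pE t : p t = H y t - P (t +i* y).
    rewrite /p mulr1; congr (_ - P _).
    by rewrite /real_complex_def /=; congr (_ +i* _); rewrite ?add0r ?addr0.
  have -> : (H y b - H y a) - (P (b +i* y) - P (a +i* y)) = p b - p a.
    by rewrite !pE; ring.
  apply: (@rderiv_mean_value _ p
    (fun t => f (t +i* y) - (f z + f' z * (t +i* y - z)) * 1)) => // t tab.
    apply: rderivB => //.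
    have -> : t +i* y = (0 +i* y) + t%:C * 1.
      by rewrite mulr1 /real_complex_def /=; congr (_ +i* _); rewrite ?add0r ?addr0.
    exact: cderiv_line.
  by rewrite mulr1 opprD addrA; apply: small.
have ver x : a <= x <= b ->
   normc ((V x d - V x c) - (P (x +i* d) - P (x +i* c))) <= e * (d - c).
  move=> ax; pose p t := V x t - P (x%:C + t%:C * 'i).
  have xE t : x +i* t = x%:C + t%:C * 'i.
    rewrite /real_complex_def /=; congr (_ +i* _); ring.
  have pE t : p t = V x t - P (x +i* t) by rewrite /p xE.
  have -> : (V x d - V x c) - (P (x +i* d) - P (x +i* c)) = p d - p c.
    by rewrite !pE; ring.
  apply: (@rderiv_mean_value _ p
    (fun t => f (x +i* t) * 'i - (f z + f' z * (x +i* t - z)) * 'i)) => // t tcd.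
    by apply: rderivB => //; rewrite xE; apply: cderiv_line.
  rewrite -mulrBl normcM normc_imag normr1 mulr1 opprD addrA; exact: small.
have aI : a <= a <= b by rewrite lexx.
have bI : a <= b <= b by rewrite lexx ab.
have cI : c <= c <= d by rewrite lexx.
have dI : c <= d <= d by rewrite lexx cd.
have -> : boundary a b c d =
  ((H c b - H c a) - (P (b +i* c) - P (a +i* c)))
  + ((V b d - V b c) - (P (b +i* d) - P (b +i* c)))
  + - ((H d b - H d a) - (P (b +i* d) - P (a +i* d)))
  + - ((V a d - V a c) - (P (a +i* d) - P (a +i* c))).
  by rewrite /boundary; ring.
apply: (le_trans (normcDE _ _)); rewrite normcNE.
apply: (le_trans (lerD (normcDE _ _) (lexx _))); rewrite normcNE.
apply: (le_trans (lerD (lerD (normcDE _ _) (lexx _)) (lexx _))).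
have := hor _ cI; have := hor _ dI; have := ver _ aI; have := ver _ bI; lra.
Qed.

Lemma boundary0_pos a c p q : 0 <= p -> 0 <= q ->
  boundary a (a + p) c (c + q) = 0.
Proof.
move=> p0 q0.
pose nextP n (s s' : R * R) :=
  [/\ s'.1 = s.1 \/ s'.1 = s.1 + p / 2 ^+ n.+1,
      s'.2 = s.2 \/ s'.2 = s.2 + q / 2 ^+ n.+1 &
   normc (boundary s.1 (s.1 + p / 2 ^+ n) s.2 (s.2 + q / 2 ^+ n)) <=
   4 * normc (boundary s'.1 (s'.1 + p / 2 ^+ n.+1) s'.2 (s'.2 + q / 2 ^+ n.+1))].
have hE (r : R) n : r / 2 ^+ n / 2 = r / 2 ^+ n.+1.
  by rewrite exprSr invfM mulrA.
have /choice[nx nxP] : forall ns : nat * (R * R), exists s', nextP ns.1 ns.2 s'.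
  move=> [n s].
  have [a' [c' [h1 h2 h3]]] := boundary_quarter s.1 s.2 (p / 2 ^+ n) (q / 2 ^+ n).
  by exists (a', c'); rewrite /nextP /= -!hE.
pose s := fix s n := if n is m.+1 then nx (m, s m) else (a, c).
have sP n : nextP n (s n) (s n.+1) by exact: nxP (n, s n).
have nested (r : R) (x : nat -> R) : 0 <= r ->
   (forall n, x n.+1 = x n \/ x n.+1 = x n + r / 2 ^+ n.+1) ->
   exists y, forall n, x n <= y <= x n + r / 2 ^+ n.
  move=> r0 xP; apply: nested_intervals => // n.
  have := divr_ge0 r0 (exprn_ge0 n.+1 (ler0n R 2)).
  by rewrite -(hE r n); case: (xP n) => ->; rewrite -?(hE r n); lra.
have [x0 x0P] := nested _ (fun n => (s n).1) p0 (fun n => let: And3 h _ _ := sP n in h).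
have [y0 y0P] := nested _ (fun n => (s n).2) q0 (fun n => let: And3 _ h _ := sP n in h).
pose W n := boundary (s n).1 ((s n).1 + p / 2 ^+ n) (s n).2 ((s n).2 + q / 2 ^+ n).
have W0 n : normc (boundary a (a + p) c (c + q)) <= 4 ^+ n * normc (W n).
  elim: n => [|n IH]; first by rewrite /W /= !expr0 !divr1 mul1r.
  apply: (le_trans IH); rewrite exprSr -mulrA ler_wpM2l ?exprn_ge0 //.
  by case: (sP n).
apply: eq0_normc; apply/eqP; rewrite eq_le normc_ge0 andbT.
apply/ler_addgt0Pr => e e0; rewrite add0r.
(* The bound is 4^n 2 (e / K) D^2 with D = (p + q) / 2^n: the powers of 2 cancel and the value is at
   most e. The added 1 keeps K positive when p = q = 0. *)
pose K := 2 * (p + q) ^+ 2 + 1.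
have K0 : 0 < K by rewrite ltr_pwDr // mulr_ge0 // sqr_ge0.
have [d d0 dP] := f_deriv (x0 +i* y0) (divr_gt0 e0 K0).
have [n nd] := half_pow_lt (p + q) d0.
apply: (le_trans (W0 n)).
have pn : 0 <= p / 2 ^+ n by rewrite divr_ge0 // exprn_ge0.
have qn : 0 <= q / 2 ^+ n by rewrite divr_ge0 // exprn_ge0.
pose D := (p + q) / 2 ^+ n.
have DE : D = p / 2 ^+ n + q / 2 ^+ n by rewrite /D mulrDl.
have WD : normc (W n) <= 2 * (e / K * D) * D.
  rewrite {2}DE /W.
  have -> : p / 2 ^+ n + q / 2 ^+ n = ((s n).1 + p / 2 ^+ n - (s n).1) +
     ((s n).2 + q / 2 ^+ n - (s n).2) by ring.
  apply: (@boundary_small (x0 +i* y0)); rewrite ?lerDl // => x y xI yI.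
  have nD : normc ((x +i* y) - (x0 +i* y0)) <= D.
    apply: (le_trans (normc_le_ReIm _)); rewrite ReB ImB /= DE.
    have := x0P n; have := y0P n => yn xn.
    by apply: lerD; rewrite ler_norml; lra.
  have := dP (x +i* y - (x0 +i* y0)) (le_lt_trans nD nd).
  rewrite [x0 +i* y0 + _]addrC subrK => /le_trans; apply.
  by rewrite ler_wpM2l // divr_ge0 // ltW.
apply: (le_trans (ler_wpM2l (exprn_ge0 _ _) WD)) => //.
have -> : 4 ^+ n * (2 * (e / K * D) * D) = e * (2 * (p + q) ^+ 2 / K).
  rewrite /D -[4]/((2 * 2)%:R) natrM exprMn; field.
  by rewrite (gt_eqF K0) expf_neq0.
rewrite -[leRHS]mulr1 ler_wpM2l ?(ltW e0) // ler_pdivrMr // mul1r /K; lra.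
Qed.

Lemma boundary0 a b c d : boundary a b c d = 0.
Proof.
have wlogb : forall a b c d, a <= b -> boundary a b c d = 0.
  move=> {a b c d} a b c d ab.
  have [cd|/ltW dc] := leP c d.
    have -> : b = a + (b - a) by ring.
    have -> : d = c + (d - c) by ring.
    by apply: boundary0_pos; rewrite subr_ge0.
  have -> : boundary a b c d = - boundary a b d c by rewrite /boundary; ring.
  have -> : b = a + (b - a) by ring.
  have -> : c = d + (c - d) by ring.
  by rewrite boundary0_pos ?oppr0 // subr_ge0.
have [ab|/ltW ba] := leP a b; first exact: wlogb.
have -> : boundary a b c d = - boundary b a c d by rewrite /boundary; ring.
by rewrite wlogb ?oppr0.
Qed.

End Goursat.

(** * Primitives, second-order expansions and local maxima *)

Section IdentityTheorem.
Local Open Scope classical_set_scope.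
Local Open Scope ring_scope.
Local Open Scope complex_scope.
Variable R : realType.
Local Notation C := R[i].
Implicit Types (f g : C -> C).

(** F(x + i y) is the integral of f along the horizontal segment from 1 + i y. As f vanishes on the
    line Re z = 1, that side of a rectangle contributes nothing, and Goursat's lemma expresses the
    increment of F by a vertical and a horizontal segment near z. *)
Lemma entire_primitive f f' : (forall z, cderiv f z (f' z)) ->
  (forall z, 0 < complex.Re z -> f z = 0) ->
  exists F, (forall z, cderiv F z (f z)) /\
            (forall z, 0 < complex.Re z -> F z = 0).
Proof.
move=> fD f0.
have cont z := cderiv_continuous (fD z).
have /choice[H HD] : forall y, exists P, forall t, rderiv P t (f (t +i* y)).
  move=> y; apply: rderiv_primitive => t e e0.
  have [d d0 dP] := cont (t +i* y) e e0; exists d => // k kd.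
  have -> : (t + k) +i* y = (t +i* y) + k%:C.
    by rewrite /real_complex_def /=; congr (_ +i* _); rewrite addr0.
  by apply: dP; rewrite normc_real.
have /choice[V VD] : forall x, exists P, forall t, rderiv P t (f (x +i* t) * 'i).
  move=> x; apply: rderiv_primitive => t e e0.
  have [d d0 dP] := cont (x +i* t) e e0; exists d => // k kd.
  have -> : x +i* (t + k) = (x +i* t) + (0 +i* k).
    by congr (_ +i* _); rewrite addr0.
  rewrite -mulrBl normcM normc_imag normr1 mulr1.
  by apply: dP; rewrite normc_imag.
have V1 s t : V 1 s = V 1 t.
  apply/eqP; rewrite -subr_eq0; apply/eqP/eq0_normc/eqP.
  rewrite eq_le normc_ge0 andbT -(mul0r `|s - t|).
  apply: rderiv_mean_value_sym (fun u _ => VD 1 u) _ => u _.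
  by rewrite f0 ?mul0r ?normc0.
pose F z := H (complex.Im z) (complex.Re z) - H (complex.Im z) 1.
exists F; split=> [z|[x y] /= x0]; last first.
  apply/eq0_normc/eqP; rewrite eq_le normc_ge0 andbT -(mul0r `|x - 1|).
  apply: rderiv_mean_value_sym (fun u _ => HD y u) _ => u /andP[xu _].
  rewrite f0 ?normc0 //=; apply: lt_le_trans xu.
  by rewrite lt_min x0 ltr01.
case: z => x y e e0.
have e20 : 0 < e / 2 by rewrite divr_gt0.
have [d d0 dP] := cont (x +i* y) _ e20; exists (d / 2); first exact: divr_gt0.
case=> k l hd.
have hk := le_lt_trans (Re_le_normc (k +i* l)) hd.
have hl := le_lt_trans (Im_le_normc (k +i* l)) hd.
move: hk hl => /= hk hl.
have FE : F ((x +i* y) + (k +i* l)) - F (x +i* y) =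
   (H (y + l) (x + k) - H (y + l) x) + (V x (y + l) - V x y).
  have := boundary0 fD HD VD 1 x y (y + l).
  rewrite /boundary /F /= (V1 _ y) => E.
  apply/eqP; rewrite -subr_eq0; apply/eqP; rewrite -[RHS]oppr0 -E; ring.
have hz : f (x +i* y) * (k +i* l) = f (x +i* y) * k%:C + f (x +i* y) * 'i * l%:C.
  rewrite -mulrA -mulrDr; congr (_ * _).
  by rewrite /real_complex_def /=; congr (_ +i* _); ring.
rewrite FE hz.
have mid (r s t : R) : Num.min r s <= t <= Num.max r s -> `|t - r| <= `|s - r|.
  have [rs|/ltW sr] := leP r s => /andP[h1 h2].
    by rewrite !ger0_norm ?subr_ge0 // lerD2r.
  by rewrite distrC [leRHS]distrC !ger0_norm ?subr_ge0 // lerD2l lerN2.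
have B1 : normc (H (y + l) (x + k) - H (y + l) x - f (x +i* y) * k%:C) <= e / 2 * `|k|.
  pose p t := H (y + l) t - f (x +i* y) * t%:C.
  have -> : H (y + l) (x + k) - H (y + l) x - f (x +i* y) * k%:C = p (x + k) - p x.
    by rewrite /p rmorphD /=; ring.
  have {2}-> : k = (x + k) - x by ring.
  apply: (@rderiv_mean_value_sym _ p (fun t => f (t +i* (y + l)) - f (x +i* y))).
    move=> t _; apply: rderivB; first exact: HD.
    move=> r r0; exists 1 => // j _.
    rewrite (_ : _ - _ = 0); last by rewrite rmorphD /=; ring.
    by rewrite normc0 mulr_ge0 // ltW.
  move=> t /mid tk; have -> : t +i* (y + l) = (x +i* y) + ((t - x) +i* l).
    by congr (_ +i* _); ring.
  apply: dP; apply: (le_lt_trans (normc_le_ReIm _)) => /=.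
  move: tk; have -> : x + k - x = k by ring.
  by move=> tk; lra.
have B2 : normc (V x (y + l) - V x y - f (x +i* y) * 'i * l%:C) <= e / 2 * `|l|.
  pose p t := V x t - f (x +i* y) * 'i * t%:C.
  have -> : V x (y + l) - V x y - f (x +i* y) * 'i * l%:C = p (y + l) - p y.
    by rewrite /p rmorphD /=; ring.
  have {2}-> : l = (y + l) - y by ring.
  apply: (@rderiv_mean_value_sym _ p (fun t => f (x +i* t) * 'i - f (x +i* y) * 'i)).
    move=> t _; apply: rderivB; first exact: VD.
    move=> r r0; exists 1 => // j _.
    rewrite (_ : _ - _ = 0); last by rewrite rmorphD /=; ring.
    by rewrite normc0 mulr_ge0 // ltW.
  move=> t /mid tl; have -> : x +i* t = (x +i* y) + (0 +i* (t - y)).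
    by congr (_ +i* _); ring.
  rewrite -mulrBl normcM normc_imag normr1 mulr1.
  apply: dP; rewrite normc_imag; move: tl; have -> : y + l - y = l by ring.
  by move=> tl; lra.
have -> : H (y + l) (x + k) - H (y + l) x + (V x (y + l) - V x y) -
   (f (x +i* y) * k%:C + f (x +i* y) * 'i * l%:C) =
   (H (y + l) (x + k) - H (y + l) x - f (x +i* y) * k%:C) +
   (V x (y + l) - V x y - f (x +i* y) * 'i * l%:C) by ring.
apply: (le_trans (normcDE _ _)); apply: (le_trans (lerD B1 B2)).
rewrite -mulrDr -mulrA ler_wpM2l ?(ltW e0) //.
have := Re_le_normc (k +i* l); have := Im_le_normc (k +i* l) => /=; lra.
Qed.

(** This expansion at a single point is the form in which differentiability enters
    [taylor2_no_local_max]. *)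
Definition taylor2 g z := exists b c, forall e : R, 0 < e ->
  exists2 d : R, 0 < d & forall h, normc h < d ->
  normc (g (z + h) - (g z + b * h + c * h ^+ 2)) <= e * normc h ^+ 2.

(** The first-order expansion of f is integrated along the segment from z to z + h by the mean value
    inequality. *)
Lemma taylor2_primitive f F z l : (forall w, cderiv F w (f w)) -> cderiv f z l ->
  taylor2 F z.
Proof.
move=> FD fD; exists (f z), (l / 2) => e e0.
have [d d0 dP] := fD e e0; exists d => // h hd.
pose p t := F (z + t%:C * h) - (f z * h * t%:C + l / 2 * h ^+ 2 * (t%:C) ^+ 2).
have -> : F (z + h) - (F z + f z * h + l / 2 * h ^+ 2) = p 1 - p 0.
  by rewrite /p !mul1r !mul0r addr0; ring.
have -> : e * normc h ^+ 2 = e * normc h ^+ 2 * (1 - 0) by ring.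
apply: (@rderiv_mean_value _ p
   (fun t => f (z + t%:C * h) * h - (f z * h + l * h ^+ 2 * t%:C))) => // t t01.
  apply: rderivB; first exact: cderiv_line.
  move=> r r0; set m := l / 2 * h ^+ 2.
  have m1 : 0 < normc m + 1 by rewrite ltr_pwDr // normc_ge0.
  exists (r / (normc m + 1)); first exact: divr_gt0.
  move=> k; rewrite ltr_pdivlMr // => kr.
  have -> : f z * h * (t + k)%:C + m * (t + k)%:C ^+ 2 -
     (f z * h * t%:C + m * t%:C ^+ 2) - (f z * h + l * h ^+ 2 * t%:C) * k%:C =
     (m * k%:C) * k%:C by rewrite /m rmorphD /=; field.
  rewrite normcM normc_real ler_wpM2r // normcM normc_real; apply: le_trans (ltW kr).
  by rewrite mulrC ler_wpM2l // lerDl.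
have -> : f (z + t%:C * h) * h - (f z * h + l * h ^+ 2 * t%:C) =
   (f (z + t%:C * h) - f z - l * (t%:C * h)) * h by ring.
have th : normc (t%:C * h) <= normc h.
  by rewrite normcM normc_real -[leRHS]mul1r ler_wpM2r ?normc_ge0 // ger0_norm; lra.
rewrite normcM expr2 [e * _]mulrA ler_wpM2r ?normc_ge0 //.
by rewrite (le_trans (dP _ (le_lt_trans th hd))) // ler_wpM2l // ltW.
Qed.

Lemma taylor2M f g z : taylor2 f z -> taylor2 g z -> taylor2 (fun w => f w * g w) z.
Proof.
move=> [b [c fT]] [b' [c' gT]].
exists (f z * b' + b * g z), (f z * c' + b * b' + c * g z) => e e0.
pose K := normc (f z) + normc b + normc c + normc (g z) + normc b' + normc c' + 1.
have [a0 b0 c0] := And3 (normc_ge0 (f z)) (normc_ge0 b) (normc_ge0 c).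
have [a0' b0' c0'] := And3 (normc_ge0 (g z)) (normc_ge0 b') (normc_ge0 c').
have K1 : 1 <= K by rewrite /K; lra.
have K0 : 0 < K by lra.
(* The three error terms below contribute 2 K, K and 2 K^2 times r |h|^2, at most 5 K^2 in all since
   K >= 1. *)
have r0 : 0 < e / (5 * K ^+ 2) by rewrite divr_gt0 // mulr_gt0 // exprn_gt0.
have [r [rP r1 re]] : exists r : R, [/\ 0 < r, r <= 1 & r * (5 * K ^+ 2) <= e].
  exists (Num.min 1 (e / (5 * K ^+ 2))); split.
  - by rewrite lt_min ltr01.
  - by rewrite ge_min lexx.
  - by rewrite -ler_pdivlMr ?mulr_gt0 ?exprn_gt0 // ge_min lexx orbT.
have [d1 d10 P1] := fT r rP; have [d2 d20 P2] := gT r rP.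
exists (Num.min r (Num.min d1 d2)); first by rewrite !lt_min rP d10.
move=> h; rewrite !lt_min => /and3P[hr h1 h2].
set P := f z + b * h + c * h ^+ 2; set Q := g z + b' * h + c' * h ^+ 2.
have n0 := normc_ge0 h; have n1 : normc h <= 1 by lra.
have n2 : normc h ^+ 2 <= 1 by nra.
have PK : normc P <= K.
  apply: (le_trans (normcDE _ _)); apply: (le_trans (lerD (normcDE _ _) (lexx _))).
  by rewrite !normcM -expr2 /K; nra.
have QK : normc Q <= K.
  apply: (le_trans (normcDE _ _)); apply: (le_trans (lerD (normcDE _ _) (lexx _))).
  by rewrite !normcM -expr2 /K; nra.
have E1 := P1 _ h1; have E2 := P2 _ h2.
rewrite -/P in E1; rewrite -/Q in E2.
set u := f (z + h) - P in E1; set v := g (z + h) - Q in E2.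
have -> : f (z + h) * g (z + h) - (f z * g z + (f z * b' + b * g z) * h +
    (f z * c' + b * b' + c * g z) * h ^+ 2) =
   u * g (z + h) + P * v + (b * c' + c * b' + c * c' * h) * h * h ^+ 2.
  by rewrite /u /v /P /Q; ring.
have gK : normc (g (z + h)) <= 2 * K.
  have -> : g (z + h) = v + Q by rewrite /v subrK.
  apply: (le_trans (normcDE _ _)); nra.
apply: (le_trans (normcDE _ _)); apply: (le_trans (lerD (normcDE _ _) (lexx _))).
set w := b * c' + _ + _.
have wK : normc w <= 2 * K ^+ 2.
  have [x1 x2] : normc b <= K /\ normc c <= K by rewrite /K; lra.
  have [x3 x4] : normc b' <= K /\ normc c' <= K by rewrite /K; lra.
  apply: (le_trans (normcDE _ _)); apply: (le_trans (lerD (normcDE _ _) (lexx _))).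
  rewrite !normcM.
  have : normc c * normc c' * normc h <= normc c * normc c'.
    by rewrite -[leRHS]mulr1 ler_wpM2l // mulr_ge0.
  have : normc b * normc c' + normc c * normc b' + normc c * normc c' <=
    (normc b + normc c) * (normc b' + normc c') by nra.
  have : (normc b + normc c) * (normc b' + normc c') <= K * K.
    by rewrite ler_pM ?addr_ge0 // /K; lra.
  by rewrite expr2; nra.
rewrite (normcM u) (normcM P) (normcM (w * h)) (normcM w) normcX; set n := normc h ^+ 2 in E1 E2 *.
have nn : 0 <= n by rewrite exprn_ge0.
have T1 : normc u * normc (g (z + h)) <= r * n * (2 * K) by rewrite ler_pM ?normc_ge0.
have T2 : normc P * normc v <= K * (r * n) by rewrite ler_pM ?normc_ge0.
have T3 : normc w * normc h * n <= 2 * K ^+ 2 * r * n.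
  by rewrite ler_wpM2r // ler_pM ?normc_ge0 // ltW.
have KK : K <= K ^+ 2 by rewrite expr2 ler_peMr // ltW.
apply: (@le_trans _ _ (r * (5 * K ^+ 2) * n)); last by rewrite ler_wpM2r.
have rn : 0 <= r * n by rewrite mulr_ge0 // ltW.
have : r * n * K <= r * n * K ^+ 2 by rewrite ler_wpM2l.
move: T1 T2 T3; move: (normc u * _) (normc P * _) (normc w * _ * _) => t1 t2 t3; nra.
Qed.

Lemma taylor2_inv (b z : C) : z != b -> taylor2 (fun w => (w - b)^-1) z.
Proof.
rewrite -subr_eq0 => zb; set w := z - b in zb *.
exists (- (w ^- 2)), (w ^- 3) => e e0.
have w0 : 0 < normc w by rewrite normc_gt0.
(* The error has modulus |h|^3 / |w^3 (w + h)|: the first bound on |h| gives |w + h| >= |w| / 2, and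
   the second then gives e |h|^2. *)
exists (Num.min (normc w / 2) (e * normc w ^+ 4 / 2)).
  by rewrite lt_min divr_gt0 // divr_gt0 // mulr_gt0 // exprn_gt0.
move=> h; rewrite lt_min => /andP[h1 h2].
have wh : normc w / 2 <= normc (w + h).
  have : normc w <= normc (w + h) + normc h.
    have {1}-> : w = (w + h) - h by ring.
    by apply: (le_trans (normcDE _ _)); rewrite normcNE.
  lra.
have wh0 : w + h != 0 by rewrite -normc_gt0; apply: lt_le_trans wh; rewrite divr_gt0.
have -> : z + h - b = w + h by rewrite /w; ring.
have -> : (w + h)^-1 - (w^-1 + - w ^- 2 * h + w ^- 3 * h ^+ 2) =
    - (h / (w ^+ 3 * (w + h)) * h ^+ 2).
  by field; rewrite wh0 zb.
rewrite normcNE normcM [in leRHS]mulrC [in leLHS]mulrC normcX ler_wpM2l ?exprn_ge0 ?normc_ge0 //.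
rewrite normcM normcV normcM normcX ler_pdivrMr; last first.
  by rewrite mulr_gt0 ?exprn_gt0 // normc_gt0.
apply: (le_trans (ltW h2)).
have -> : e * normc w ^+ 4 / 2 = e * (normc w ^+ 3 * (normc w / 2)) by field.
by rewrite ler_wpM2l ?(ltW e0) // ler_wpM2l // exprn_ge0 // ltW.
Qed.

Lemma taylor2_cst (c : C) z : taylor2 (fun=> c) z.
Proof.
exists 0, 0 => e e0; exists 1 => // h _.
by rewrite !mul0r !addr0 subrr normc0 mulr_ge0 ?(ltW e0) // exprn_ge0 // normc_ge0.
Qed.

Lemma taylor2X f z n : taylor2 f z -> taylor2 (fun w => f w ^+ n) z.
Proof.
move=> fT; elim: n => [|n IH]; first exact: taylor2_cst.
rewrite (_ : (fun w => _) = fun w => f w * f w ^+ n); first exact: taylor2M.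
by apply/funext => w; rewrite exprS.
Qed.

(* The mean of |g|^2 over z + t, z + i t, z - t, z - i t is at least
   |g(z)|^2 - o(t^2), hence e |w - c|^2 prevents a maximum at z. *)
Lemma taylor2_no_local_max g z (c : C) (e d : R) : taylor2 g z -> 0 < e -> 0 < d ->
  exists2 h, normc h < d & normc (g z) ^+ 2 + e * normc (z - c) ^+ 2 <
     normc (g (z + h)) ^+ 2 + e * normc (z + h - c) ^+ 2.
Proof.
move=> [b [a gT]] e0 d0; apply: contrapT => nomax.
have max h : normc h < d -> normc (g (z + h)) ^+ 2 + e * normc (z + h - c) ^+ 2 <=
    normc (g z) ^+ 2 + e * normc (z - c) ^+ 2.
  by move=> hd; rewrite leNgt; apply/negP => lt; apply: nomax; exists h.
pose K := normc (g z) + normc b + normc a + 1.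
have [a0 b0 c0] := And3 (normc_ge0 (g z)) (normc_ge0 b) (normc_ge0 a).
have K0 : 0 < K by rewrite /K; lra.
(* Since |P h| <= K, replacing g by its expansion P costs at most 2 K (e / (4 K)) t^2 = e t^2 / 2 on
   the squared modulus, half of the gain due to e |w - c|^2. *)
have [d' d'0 dP] := gT (e / (4 * K)) (divr_gt0 e0 (mulr_gt0 (ltr0n _ 4) K0)).
pose t := Num.min 1 (Num.min (d / 2) (d' / 2)).
have t0 : 0 < t by rewrite !lt_min ltr01 !divr_gt0.
have t1 : t <= 1 by rewrite ge_min lexx.
have td : t < d.
  have : t <= d / 2 by rewrite !ge_min lexx ?orbT.
  lra.
have td' : t < d'.
  have : t <= d' / 2 by rewrite !ge_min lexx ?orbT.
  lra.
pose P h := g z + b * h + a * h ^+ 2.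
have key h : normc h = t -> normc (P h) ^+ 2 + e * normc (z + h - c) ^+ 2 <=
    normc (g z) ^+ 2 + e * normc (z - c) ^+ 2 + e / 2 * t ^+ 2.
  move=> ht; have hd : normc h < d by rewrite ht.
  have hd' : normc h < d' by rewrite ht.
  have M := max h hd; have E := dP h hd'.
  rewrite -/(P h) ht in E.
  have PK : normc (P h) <= K.
    apply: (le_trans (normcDE _ _)); apply: (le_trans (lerD (normcDE _ _) (lexx _))).
    have t2 : t ^+ 2 <= 1 by nra.
    by rewrite (normcM b) (normcM a) normcX ht /K; nra.
  have PE : normc (P h) <= normc (g (z + h)) + e / (4 * K) * t ^+ 2.
    have {1}-> : P h = g (z + h) - (g (z + h) - P h) by ring.
    by apply: (le_trans (normcDE _ _)); rewrite normcNE lerD2l.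
  have eK : e / (4 * K) * t ^+ 2 * (2 * K) = e / 2 * t ^+ 2 by field; rewrite gt_eqF.
  have s0 : 0 <= e / (4 * K) * t ^+ 2.
    by rewrite mulr_ge0 ?exprn_ge0 ?(ltW t0) // divr_ge0 ?(ltW e0) // mulr_ge0 // ltW.
  have q0 := normc_ge0 (g (z + h)); have p0 := normc_ge0 (P h).
  have {PE} : normc (P h) ^+ 2 <=
      normc (g (z + h)) ^+ 2 + e / (4 * K) * t ^+ 2 * (2 * K).
    move: p0 q0 PE PK s0; move: (normc (P h)) (normc (g (z + h))) (e / (4 * K) * _).
    by move=> p q s p0 q0 pq pK s0; have [ps|sp] := leP p s; nra.
  by rewrite eK; lra.
have k1 := key t%:C _; have k2 := key (0 +i* t) _.
have k3 := key (- t)%:C _; have k4 := key (0 +i* (- t)) _.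
rewrite !normc_real normrN gtr0_norm // in k1 k3.
rewrite !normc_imag normrN gtr0_norm // in k2 k4.
move: {k1 k2 k3 k4} (k1 erefl) (k2 erefl) (k3 erefl) (k4 erefl).
(* Over the four increments the sums of h, of h^2 and of their conjugates vanish, so adding the
   inequalities leaves 4 |b|^2 t^2 + 4 |a|^2 t^4 + 4 e t^2 <= 2 e t^2. *)
rewrite !normc_sqr /P.
have et : 0 < e * t ^+ 2 by rewrite mulr_gt0 // exprn_gt0.
clear -et.
case: (g z) => g1 g2; case: b => b1 b2; case: a => a1 a2; case: z => z1 z2; case: c => c1 c2.
rewrite !expr2 /=; move=> k1 k2 k3 k4.
have := sqr_ge0 (b1 * t); have := sqr_ge0 (b2 * t).
have := sqr_ge0 (a1 * t ^+ 2); have := sqr_ge0 (a2 * t ^+ 2).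
move: k1 k2 k3 k4; lra.
Qed.

Lemma continuous_rectangle_max (u : C -> R) (a b c d : R) : a <= b -> c <= d ->
  (forall x y, a <= x <= b -> c <= y <= d -> forall e : R, 0 < e ->
    exists2 r : R, 0 < r & forall h, normc h < r ->
      `|u (x +i* y + h) - u (x +i* y)| <= e) ->
  exists x y, [/\ a <= x <= b, c <= y <= d &
    forall x' y', a <= x' <= b -> c <= y' <= d -> u (x' +i* y') <= u (x +i* y)].
Proof.
move=> ab cd uC.
have comp : compact (`[a, b] `*` `[c, d] : set (R * R)%type).
  by apply: compact_setX; exact: segment_compact.
have [||[x y] xyA xyM] := compact_EVT_max _ comp (_ : {within _, continuous
    (fun p : R * R => u (p.1 +i* p.2))}).
- by exists (a, c); split; rewrite /= in_itv /= lexx.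
- apply/continuous_in_subspaceT => -[x y]; rewrite inE => -[/= + +].
  rewrite !in_itv /= => xI yI; apply/cvgrPdist_le => e e0.
  have [r r0 rP] := uC _ _ xI yI e e0.
  exists (ball x (r / 2), ball y (r / 2)).
    by split; apply: nbhsx_ballx; rewrite divr_gt0.
  move=> [x' y'] [/=]; rewrite /ball /= => hx hy.
  rewrite distrC; have -> : x' +i* y' = x +i* y + ((x' - x) +i* (y' - y)).
    by congr (_ +i* _); ring.
  apply: rP; apply: (le_lt_trans (normc_le_ReIm _)) => /=.
  by rewrite (distrC x') (distrC y'); lra.
move: xyA; rewrite inE => -[/=]; rewrite !in_itv /= => xI yI.
exists x, y; split=> // x' y' xI' yI'.
by apply: (xyM (x', y')); rewrite inE; split; rewrite /= in_itv.
Qed.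

End IdentityTheorem.

(** * Vanishing on the whole plane by the maximum principle *)

Section Vanishing.
Local Open Scope classical_set_scope.
Local Open Scope ring_scope.
Local Open Scope complex_scope.
Variable R : realType.
Local Notation C := R[i].

Lemma expr_lt_small (M q y : R) : 0 <= q -> q < 1 -> 0 < y ->
  exists n, M * q ^+ n < y.
Proof.
move=> q0 q1 y0; have M1 : 0 < `|M| + 1 by rewrite ltr_pwDr.
have q1' : `|q| < 1 by rewrite ger0_norm.
have /cvgrPdist_lt/(_ _ (divr_gt0 y0 M1)) [n _ nP] := cvg_expr q1'.
exists n; have := nP n (leqnn n); rewrite /= sub0r normrN ger0_norm ?exprn_ge0 //.
rewrite ltr_pdivlMr // => H; apply: le_lt_trans H; rewrite mulrC ler_wpM2l ?exprn_ge0 //.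
by apply: (le_trans (ler_norm _)); rewrite lerDl.
Qed.

Definition continuous_modulus (u : C -> R) (z : C) := forall e : R, 0 < e ->
  exists2 r : R, 0 < r & forall h, normc h < r -> `|u (z + h) - u z| <= e.

Lemma continuous_modulusD u v z : continuous_modulus u z ->
  continuous_modulus v z -> continuous_modulus (fun w => u w + v w) z.
Proof.
move=> uC vC e e0; have e20 : 0 < e / 2 by rewrite divr_gt0.
have [d1 d10 P1] := uC _ e20; have [d2 d20 P2] := vC _ e20.
exists (Num.min d1 d2); first by rewrite lt_min d10.
move=> h; rewrite lt_min => /andP[/P1 h1 /P2 h2].
have -> : u (z + h) + v (z + h) - (u z + v z) = (u (z + h) - u z) + (v (z + h) - v z) by ring.
by apply: (le_trans (ler_normD _ _)); lra.
Qed.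

Lemma continuous_modulusM u v z : continuous_modulus u z ->
  continuous_modulus v z -> continuous_modulus (fun w => u w * v w) z.
Proof.
move=> uC vC e e0; pose K := `|u z| + `|v z| + 1.
have [uz vz] := (normr_ge0 (u z), normr_ge0 (v z)).
have K0 : 0 < K by rewrite /K; lra.
have e20 : 0 < Num.min 1 (e / (2 * K)).
  by rewrite lt_min ltr01 divr_gt0 // mulr_gt0.
have [d1 d10 P1] := uC _ e20; have [d2 d20 P2] := vC _ e20.
exists (Num.min d1 d2); first by rewrite lt_min d10.
move=> h; rewrite lt_min => /andP[/P1 + /P2].
rewrite !le_min => /andP[_ h1] /andP[h21 h2].
have -> : u (z + h) * v (z + h) - u z * v z =
  (u (z + h) - u z) * v (z + h) + u z * (v (z + h) - v z) by ring.
have vK : `|v (z + h)| <= K.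
  have -> : v (z + h) = (v (z + h) - v z) + v z by ring.
  by apply: (le_trans (ler_normD _ _)); rewrite /K; lra.
have uK : `|u z| <= K by rewrite /K; lra.
apply: (le_trans (ler_normD _ _)); rewrite !normrM.
have -> : e = e / (2 * K) * K + K * (e / (2 * K)) by field; rewrite gt_eqF.
by apply: lerD; rewrite ler_pM.
Qed.

Lemma continuous_normc (f : C -> C) z :
  (forall e : R, 0 < e -> exists2 d : R, 0 < d &
    forall h, normc h < d -> normc (f (z + h) - f z) <= e) ->
  continuous_modulus (fun w => normc (f w)) z.
Proof.
move=> fC e e0; have [r r0 rP] := fC e e0.
exists r => // h /rP; apply: le_trans; rewrite ler_norml; apply/andP; split.
  have := normcDE (f z - f (z + h)) (f (z + h)); rewrite subrK normc_distC; lra.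
have := normcDE (f (z + h) - f z) (f z); rewrite subrK; lra.
Qed.

Lemma taylor2_cderiv (g : C -> C) z : taylor2 g z -> exists l : C, cderiv g z l.
Proof.
move=> [b [c gT]]; exists b => e e0; have [d d0 dP] := gT 1 ltr01.
have c1 : 0 < normc c + 1 by rewrite ltr_pwDr // normc_ge0.
exists (Num.min d (e / (normc c + 1))); first by rewrite lt_min d0 divr_gt0.
move=> h; rewrite lt_min ltr_pdivlMr // => /andP[/dP hd he].
have -> : g (z + h) - g z - b * h =
   (g (z + h) - (g z + b * h + c * h ^+ 2)) + c * h ^+ 2 by ring.
apply: (le_trans (normcDE _ _)); apply: (le_trans (lerD hd (lexx _))).
rewrite normcM normcX -mulrDl expr2 mulrA ler_wpM2r ?normc_ge0 //.
by rewrite addrC mulrC ltW.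
Qed.

(* Maximum principle for F(z) / (z - b)^n on a rectangle: on the side Re z = 1
   the function F vanishes, on the other ones |z - b| > |w - b|. *)
Lemma twice_derivable_eq0 (f F : C -> C) (f' : C -> C) :
  (forall z, cderiv F z (f z)) -> (forall z, cderiv f z (f' z)) ->
  (forall z, 0 < complex.Re z -> F z = 0) -> forall z, F z = 0.
Proof.
move=> FD fD F0 [w1 w2]; have [/F0//|w10] := ltP 0 (complex.Re (w1 +i* w2)).
move: w10 => /= w10; set w := w1 +i* w2; apply: contrapT => /eqP Fw.
(* The point b is at distance s from w, and the rectangle is the part Re z <= 1 of the square of
   centre b and half-side S > s; it avoids b. *)
pose b : C := 2 +i* w2; pose s := 2 - w1; pose S := s + 1.
have s0 : 0 < s by rewrite /s; lra.
have S0 : 0 < S by rewrite /S; lra.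
have wb : normc (w - b) = s.
  have -> : w - b = (w1 - 2)%:C by rewrite /real_complex_def /=; congr (_ +i* _); ring.
  by rewrite normc_real distrC ger0_norm // ltW.
pose inX x y := (2 - S <= x <= 1) && (w2 - S <= y <= w2 + S).
have xI : 2 - S <= 1 by rewrite /S /s; lra.
have yI : w2 - S <= w2 + S by lra.
have Fcont z : continuous_modulus (fun z => normc (F z)) z.
  by apply: continuous_normc; exact: cderiv_continuous (FD z).
have [x0 [y0 [_ _ Fmax]]] := @continuous_rectangle_max R (fun z => normc (F z)) _ _ _ _
  xI yI (fun x y _ _ => Fcont (x +i* y)).
set M := normc _ in Fmax.
have M0 : 0 <= M by exact: normc_ge0.
have sS : s / S < 1 by rewrite ltr_pdivrMr // /S; lra.
have sS0 : 0 <= s / S by rewrite divr_ge0 // ltW.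
have Fw0 : 0 < normc (F w) by rewrite normc_gt0.
(* With this n, |g(w)| = |F(w)| / s^n exceeds M / S^n, which bounds |g| on the sides at distance at
   least S from b. *)
have [n nP] := expr_lt_small M sS0 sS Fw0.
have sn0 : 0 < s ^+ n by rewrite exprn_gt0.
have Sn0 : 0 < S ^+ n by rewrite exprn_gt0.
pose g z := F z * ((z - b)^-1) ^+ n.
have gw : M / S ^+ n < normc (g w).
  rewrite /g normcM normcX normcV wb exprVn ltr_pdivlMr //.
  by apply: le_lt_trans nP; rewrite expr_div_n mulrAC mulrA.
have MS0 : 0 <= M / S ^+ n by rewrite divr_ge0 // ltW.
have S20 : 0 < 8 * S ^+ 2 + 1 by rewrite ltr_pwDr // mulr_ge0 // exprn_ge0 // ltW.
(* The perturbation e |z - b|^2, at most 2 e S^2 on the rectangle, does not fill the gap between (M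
   / S^n)^2 and |g(w)|^2; a maximum of U therefore lies in the interior. *)
have [e [e0 eE]] : exists e : R, 0 < e /\
    e * (8 * S ^+ 2 + 1) = normc (g w) ^+ 2 - (M / S ^+ n) ^+ 2.
  exists ((normc (g w) ^+ 2 - (M / S ^+ n) ^+ 2) / (8 * S ^+ 2 + 1)).
  rewrite divfK ?gt_eqF //; split=> //.
  by rewrite divr_gt0 // subr_gt0 ltr_pXn2r ?nnegrE ?normc_ge0.
pose U z := normc (g z) ^+ 2 + e * normc (z - b) ^+ 2.
have zb x y : inX x y -> x +i* y - b != 0.
  move=> /andP[/andP[_ x1] _]; apply/eqP => /(congr1 (@complex.Re R)).
  by rewrite ReB /=; lra.
have gT x y : inX x y -> taylor2 g (x +i* y).
  move=> /zb; rewrite subr_eq0 => zb'; apply: taylor2M.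
    exact: taylor2_primitive (fD _).
  by apply: taylor2X; exact: taylor2_inv.
have Ucont x y : inX x y -> continuous_modulus U (x +i* y).
  move=> /gT/taylor2_cderiv[l gD].
  have idc : continuous_modulus (fun z => normc (z - b)) (x +i* y).
    apply: continuous_normc => r r0; exists r => // h /ltW.
    by have -> : x +i* y + h - b - (x +i* y - b) = h by ring.
  have cste : continuous_modulus (fun=> e) (x +i* y).
    by move=> r /ltW r0; exists 1 => // h _; rewrite subrr normr0.
  have gc := continuous_normc (cderiv_continuous gD).
  apply: continuous_modulusD; first exact: continuous_modulusM.
  by apply: continuous_modulusM => //; exact: continuous_modulusM.
have [x1 [y1 [x1I y1I Umax]]] := @continuous_rectangle_max R U _ _ _ _ xI yI
  (fun x y xI yI => Ucont x y (introT andP (conj xI yI))).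
have Uw : normc (g w) ^+ 2 <= U (x1 +i* y1).
  have : U w <= U (x1 +i* y1) by apply: Umax; rewrite /S /s; lra.
  by apply: le_trans; rewrite lerDl mulr_ge0 ?exprn_ge0 ?normc_ge0 // ltW.
have Ubd : normc (g (x1 +i* y1)) <= M / S ^+ n -> False.
  move=> gM; have zS : normc (x1 +i* y1 - b) ^+ 2 <= 2 * S ^+ 2.
    have sqS (r : R) : - S <= r <= S -> r ^+ 2 <= S ^+ 2.
      by rewrite -ler_norml -(real_normK (num_real r)) => rS; apply: lerXn2r;
        rewrite ?nnegrE // ltW.
    have h1 : (x1 - 2) ^+ 2 <= S ^+ 2 by apply: sqS; move: x1I S0; clear; lra.
    have h2 : (y1 - w2) ^+ 2 <= S ^+ 2 by apply: sqS; move: y1I; clear; lra.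
    by rewrite normc_sqr ReB ImB mulrDl mul1r; exact: lerD.
  have gM2 : normc (g (x1 +i* y1)) ^+ 2 <= (M / S ^+ n) ^+ 2.
    by rewrite ler_pXn2r ?nnegrE ?normc_ge0.
  have eS : e * normc (x1 +i* y1 - b) ^+ 2 <= e * (2 * S ^+ 2) by rewrite ler_wpM2l // ltW.
  have contra (p q r S2 m2 : R) : p <= q + e * r -> q <= m2 ->
    e * r <= e * (2 * S2) -> e * (8 * S2 + 1) = p - m2 -> 0 <= e * S2 -> False.
    by clear -e0; lra.
  apply: (contra _ _ _ _ _ Uw gM2 eS eE).
  by rewrite mulr_ge0 ?exprn_ge0 // ltW.
have gS : S <= normc (x1 +i* y1 - b) -> False.
  move=> Sz; apply: Ubd; rewrite /g normcM normcX normcV.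
  rewrite ler_pM ?normc_ge0 ?exprn_ge0 ?invr_ge0 ?normc_ge0 //; first exact: Fmax.
  have z0 := lt_le_trans S0 Sz.
  rewrite exprVn lef_pV2 ?posrE ?exprn_gt0 //.
  by apply: lerXn2r => //; rewrite nnegrE ltW.
have x1lo : 2 - S < x1.
  rewrite ltNge; apply/negP => x1S; apply: gS.
  apply: le_trans (Re_le_normc _); rewrite ReB /= ler_normr; apply/orP; right; move: x1S; clear; lra.
have y1lo : w2 - S < y1.
  rewrite ltNge; apply/negP => y1S; apply: gS.
  apply: le_trans (Im_le_normc _); rewrite ImB /= ler_normr; apply/orP; right; move: y1S; clear; lra.
have y1hi : y1 < w2 + S.
  rewrite ltNge; apply/negP => y1S; apply: gS.
  apply: le_trans (Im_le_normc _); rewrite ImB /= ler_normr; apply/orP; left; move: y1S; clear; lra.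
have x1hi : x1 < 1.
  rewrite ltNge; apply/negP => x1S; apply: Ubd.
  by rewrite /g F0 ?mul0r ?normc0 //=; exact: lt_le_trans x1S.
pose d := Num.min (Num.min (x1 - (2 - S)) (1 - x1)) (Num.min (y1 - (w2 - S)) (w2 + S - y1)).
have d0 : 0 < d by rewrite /d !lt_min !subr_gt0 x1lo x1hi y1lo.
have gT1 : taylor2 g (x1 +i* y1) by apply: gT; rewrite /inX x1I.
have [[h1 h2] hd] := taylor2_no_local_max b gT1 e0 d0.
rewrite ltNge => /negP; apply.
have := Re_le_normc (h1 +i* h2); have := Im_le_normc (h1 +i* h2).
rewrite [complex.Re (_ +i* _)]/= [complex.Im (_ +i* _)]/=.
move: hd; rewrite /d !lt_min => /andP[/andP[d1 d2] /andP[d3 d4]] i1 i2.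
have [i3 i4] := (ler_norm h1, ler_norm h2).
have [i5 i6] := (ler_norm (- h1), ler_norm (- h2)); rewrite !normrN in i5 i6.
apply: Umax; move: d1 d2 d3 d4 i1 i2 i3 i4 i5 i6; clear; lra.
Qed.

Lemma cderiv_eq0_half_plane (f f' : C -> C) : (forall z, cderiv f z (f' z)) ->
  (forall z, 0 < complex.Re z -> f z = 0) -> forall z, f z = 0.
Proof.
move=> fD f0 z; have [F [FD F0]] := entire_primitive fD f0.
have FE := twice_derivable_eq0 FD fD F0.
apply/eq0_normc/eqP; rewrite eq_le normc_ge0 andbT.
apply/ler_addgt0Pr => e e0; rewrite add0r.
have [d d0 dP] := FD z e e0; have d20 : 0 < d / 2 by rewrite divr_gt0.
have := dP (d / 2)%:C; rewrite !FE subrr sub0r normcNE normcM normc_real.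
rewrite gtr0_norm // ler_pM2r //; apply; lra.
Qed.
End Vanishing.

(** * The complex exponential and the Laplace transform of polynomials *)

Section ComplexExponential.
Local Open Scope classical_set_scope.
Local Open Scope ring_scope.
Local Open Scope complex_scope.
Variable R : realType.
Local Notation C := R[i].

Lemma expCD (z w : C) : expC (z + w) = expC z * expC w.
Proof.
rewrite /expC ReD ImD expRD cosD sinD rmorphM /= mulrACA; congr (_ * _).
by congr (_ +i* _); ring.
Qed.

Lemma expC0 : expC (0 : C) = 1.
Proof. by rewrite /expC /= expR0 cos0 sin0 mulr1. Qed.

Lemma normc_expC (z : C) : normc (expC z) = expR (complex.Re z).
Proof.
rewrite /expC normcM normc_real gtr0_norm ?expR_gt0 //.
by rewrite /= cos2Dsin2 sqrtr1 mulr1.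
Qed.

Lemma rderiv_expC (w : C) (t : R) :
  rderiv (fun s => expC (s%:C * w)) t (w * expC (t%:C * w)).
Proof.
case: w => a b.
have E s : expC (s%:C * (a +i* b)) =
    (expR (s * a) * cos (s * b)) +i* (expR (s * a) * sin (s * b)).
  by rewrite /expC ReM_real ImM_real /=; congr (_ +i* _); ring.
have Dl (r : R) : is_derive t 1 (fun s : R => s * r) r.
  apply: rderiv_is_derive => e e0; exists 1 => // k _.
  rewrite (_ : _ - _ = 0); last ring.
  by rewrite normr0 mulr_ge0 // ltW.
have De : is_derive t 1 (fun s : R => expR (s * a)) (expR (t * a) * a).
  exact: (is_derive1_comp (is_derive_expR _) (Dl a)).
have Dc : is_derive t 1 (fun s : R => cos (s * b)) (- sin (t * b) * b).
  exact: (is_derive1_comp (is_derive_cos _) (Dl b)).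
have Ds : is_derive t 1 (fun s : R => sin (s * b)) (cos (t * b) * b).
  exact: (is_derive1_comp (is_derive_sin _) (Dl b)).
apply: rderiv_components.
- rewrite (_ : (fun s => _) = (fun s => expR (s * a)) * (fun s => cos (s * b))); last first.
    by apply/funext => s; rewrite E.
  have := is_deriveM De Dc; congr is_derive.
  by rewrite E /GRing.scale /=; ring.
- rewrite (_ : (fun s => _) = (fun s => expR (s * a)) * (fun s => sin (s * b))); last first.
    by apply/funext => s; rewrite E.
  have := is_deriveM De Ds; congr is_derive.
  by rewrite E /GRing.scale /=; ring.
Qed.

Lemma is_derive_exp n (t : R) :
  is_derive t 1 (fun s : R => s ^+ n.+1) (n.+1%:R * t ^+ n).
Proof.
have := is_deriveX n.+1 (is_derive_id t 1); congr is_derive; last exact: mulr1.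
by apply/funext => s; rewrite exprfctE.
Qed.

Lemma rderiv_exp_partial_sum (w : C) (t : R) n :
  rderiv (fun s => \sum_(p < n.+1) (s%:C * w) ^+ p / p`!%:R) t
    (w * \sum_(p < n) (t%:C * w) ^+ p / p`!%:R).
Proof.
elim: n => [|n IH].
  rewrite big_ord0 mulr0 (_ : (fun s => _) = fun=> 1); last first.
    by apply/funext => s; rewrite big_ord_recl big_ord0 expr0 fact0 divr1 addr0.
  move=> e /ltW e0; exists 1 => // k _.
  by rewrite mul0r subr0 subrr normc0 mulr_ge0.
rewrite (_ : (fun s => _) = fun s => \sum_(p < n.+1) (s%:C * w) ^+ p / p`!%:R +
    (s ^+ n.+1)%:C * (w ^+ n.+1 / n.+1`!%:R)); last first.
  by apply/funext => s; rewrite big_ord_recr /= exprMn rmorphXn mulrA.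
have := rderivD IH (is_derive_rderivM (w ^+ n.+1 / n.+1`!%:R) (is_derive_exp n t)).
congr rderiv; rewrite [in RHS]big_ord_recr /= mulrDr; congr (_ + _).
rewrite rmorphM rmorph_nat rmorphXn /= exprMn factS natrM exprS; field.
by rewrite nat1r !pnatr_eq0 -lt0n fact_gt0.
Qed.

(** Induction on n along the segment from 0 to w: the remainder of order n + 1 has derivative w
    times the one of order n. The factor t^n in the strengthened claim [H] is integrated by
    [rderiv_majorant], which produces the factorial. *)
Lemma expC_taylor (w : C) n : normc (expC w - \sum_(p < n) w ^+ p / p`!%:R) <=
  expR (normc w) * normc w ^+ n / n`!%:R.
Proof.
suff H t : 0 <= t <= 1 -> normc (expC (t%:C * w) - \sum_(p < n) (t%:C * w) ^+ p / p`!%:R) <=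
    expR (normc w) * normc w ^+ n / n`!%:R * t ^+ n.
  by have := H 1; rewrite mul1r expr1n mulr1; apply; rewrite ler01 lexx.
elim: n t => [|n IH] t t01.
  rewrite big_ord0 subr0 !expr0 !mulr1 fact0 divr1 normc_expC ler_expR.
  apply: (le_trans (ler_norm _)); apply: (le_trans (Re_le_normc _)).
  rewrite normcM normc_real ger0_norm; last by case/andP: t01.
  by rewrite ler_piMl ?normc_ge0 //; case/andP: t01.
pose p s := expC (s%:C * w) - \sum_(p < n.+1) (s%:C * w) ^+ p / p`!%:R.
have p0 : p 0 = 0.
  rewrite /p mul0r expC0 big_ord_recl /= expr0 fact0 divr1 big1 ?addr0 ?subrr // => i _.
  by rewrite expr0n /= mul0r.
rewrite -/(p t) -[p t]subr0 -{1}p0.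
pose K := expR (normc w) * normc w ^+ n.+1 / n.+1`!%:R.
rewrite -/K; have -> : K * t ^+ n.+1 = K * t ^+ n.+1 - K * 0 ^+ n.+1.
  by rewrite expr0n mulr0 subr0.
have t0 : 0 <= t by case/andP: t01.
apply: (@rderiv_majorant _ p
  (fun s => w * (expC (s%:C * w) - \sum_(p < n) (s%:C * w) ^+ p / p`!%:R))
  (fun s => K * s ^+ n.+1) (fun s => K * (n.+1%:R * s ^+ n)) _ _ t0) => s /andP[s0 st].
- rewrite mulrBr; apply: rderivB; first exact: rderiv_expC.
  exact: rderiv_exp_partial_sum.
- by have := is_deriveZ K (is_derive_exp n s).
- rewrite normcM; have s01 : 0 <= s <= 1 by rewrite s0 (le_trans st) //; case/andP: t01.
  apply: (le_trans (ler_wpM2l (normc_ge0 _) (IH _ s01))).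
  rewrite /K factS natrM le_eqVlt; apply/orP; left; apply/eqP.
  rewrite exprS; field.
  by rewrite pnatr_eq0 -lt0n fact_gt0 /= addrC natr1 pnatr_eq0.
Qed.

Lemma expC_series (w : C) (e : R) : 0 < e -> exists n0, forall n, (n0 <= n)%N ->
  normc (expC w - \sum_(p < n) w ^+ p / p`!%:R) <= e.
Proof.
move=> e0; have c0 : 0 < expR (normc w) := expR_gt0 _.
have /cvgrPdist_lt/(_ _ (divr_gt0 e0 c0)) [n0 _ nP] := @cvg_exp_coeff R (normc w).
exists n0 => n nn; have := nP n nn; rewrite /= sub0r normrN /exp_coeff /= => H.
apply: (le_trans (expC_taylor w n)); rewrite -mulrA mulrC -ler_pdivlMr //.
exact: le_trans (ler_norm _) (ltW H).
Qed.

Lemma cderiv_expC (z : C) : cderiv (@expC R) z (expC z).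
Proof.
move=> e e0; pose K := normc (expC z) * expR 1 + 1.
have K0 : 0 < K by rewrite ltr_pwDr // mulr_ge0 ?normc_ge0 ?expR_ge0.
exists (Num.min 1 (e / K)); first by rewrite lt_min ltr01 divr_gt0.
move=> h; rewrite lt_min ltr_pdivlMr // => /andP[h1 he].
have -> : expC (z + h) - expC z - expC z * h =
    expC z * (expC h - \sum_(p < 2) h ^+ p / p`!%:R).
  by rewrite expCD !big_ord_recl big_ord0 /= expr0 fact0 divr1 expr1 divr1 addr0; ring.
rewrite normcM; apply: (le_trans (ler_wpM2l (normc_ge0 _) (expC_taylor h 2))).
have n0 := normc_ge0 h.
have e1 : expR (normc h) <= expR 1 by rewrite ler_expR ltW.
have h2 : normc (expC z) * (expR (normc h) * normc h ^+ 2 / 2`!%:R) <=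
    normc h * K * normc h.
  have -> : normc h * K * normc h = K * normc h ^+ 2 by rewrite expr2; ring.
  rewrite mulrA mulrA mulrAC ler_wpM2r ?exprn_ge0 // ler_pdivrMr ?ltr0n //.
  have := ler_wpM2l (normc_ge0 (expC z)) e1.
  have := mulr_ge0 (normc_ge0 (expC z)) (expR_ge0 1); rewrite /K -[2`!%:R]/(2 : R); lra.
by apply: (le_trans h2); rewrite ler_wpM2r // ltW.
Qed.

Lemma cderivM (f g : C -> C) z l m : cderiv f z l -> cderiv g z m ->
  cderiv (fun w => f w * g w) z (l * g z + f z * m).
Proof.
move=> fD gD e e0; pose K := normc (g z) + normc l + normc (f z) + 1.
have [a0 b0 c0] := And3 (normc_ge0 (g z)) (normc_ge0 l) (normc_ge0 (f z)).
have K1 : 0 < K + 1 by rewrite /K; lra.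
have [r [r0 r1 rK]] : exists r : R, [/\ 0 < r, r <= 1 & r * (K + 1) <= e].
  exists (Num.min 1 (e / (K + 1))); split.
  - by rewrite lt_min ltr01 divr_gt0.
  - by rewrite ge_min lexx.
  - by rewrite -ler_pdivlMr // ge_min lexx orbT.
have [d1 d10 P1] := fD r r0; have [d2 d20 P2] := gD r r0.
have [d3 d30 P3] := cderiv_continuous gD r0.
exists (Num.min d1 (Num.min d2 d3)); first by rewrite !lt_min d10 d20.
move=> h; rewrite !lt_min => /and3P[/P1 h1 /P2 h2 /P3 h3].
have -> : f (z + h) * g (z + h) - f z * g z - (l * g z + f z * m) * h =
  (f (z + h) - f z - l * h) * (g z + (g (z + h) - g z)) + l * (g (z + h) - g z) * h
  + f z * (g (z + h) - g z - m * h) by ring.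
set D := g (z + h) - g z in h2 h3 *.
apply: (le_trans (normcDE _ _)); apply: (le_trans (lerD (normcDE _ _) (lexx _))).
rewrite !normcM.
have T1 : normc (f (z + h) - f z - l * h) * normc (g z + D) <=
    r * normc h * (normc (g z) + 1).
  rewrite ler_pM ?normc_ge0 //; apply: (le_trans (normcDE _ _)).
  by rewrite lerD2l (le_trans h3).
have T2 : normc l * normc D * normc h <= normc l * r * normc h.
  by rewrite ler_wpM2r ?normc_ge0 // ler_wpM2l.
have T3 : normc (f z) * normc (D - m * h) <= normc (f z) * (r * normc h).
  by rewrite ler_wpM2l.
apply: (@le_trans _ _ (r * (K + 1) * normc h)); last by rewrite ler_wpM2r ?normc_ge0.
have : 0 <= r * normc h by rewrite mulr_ge0 ?normc_ge0 // ltW.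
by rewrite /K; lra.
Qed.

Lemma cderiv_linear (a z : C) : cderiv (fun w => a * w) z a.
Proof.
move=> e e0; exists 1 => // h _; rewrite (_ : _ - _ = 0) ?normc0; last ring.
by rewrite mulr_ge0 ?normc_ge0 // ltW.
Qed.

Lemma cderiv_cst (a z : C) : cderiv (fun=> a) z 0.
Proof.
move=> e e0; exists 1 => // h _; rewrite subrr mul0r subrr normc0.
by rewrite mulr_ge0 ?normc_ge0 // ltW.
Qed.

Lemma cderiv_horner (p : {poly C}) (z : C) : cderiv (fun w => p.[w]) z p^`().[z].
Proof.
elim/poly_ind: p => [|p c pD].
  rewrite deriv0 horner0 (_ : (fun w => _) = fun=> 0); first exact: cderiv_cst.
  by apply/funext => w; rewrite horner0.
have := cderivB (cderivM pD (cderiv_linear 1 z)) (cderiv_cst (- c) z).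
congr cderiv.
  by apply/funext => w; rewrite mul1r opprK !hornerE.
by rewrite mul1r mulr1 subr0 derivD derivM derivX derivC addr0 mulr1 hornerD hornerM hornerX.
Qed.

Lemma cderiv_expC_linear (a z : C) :
  cderiv (fun w => expC (a * w)) z (expC (a * z) * a).
Proof.
have [->|a0] := eqVneq a 0.
  rewrite mulr0 (_ : (fun w => _) = fun=> 1); first exact: cderiv_cst.
  by apply/funext => w; rewrite mul0r expC0.
move=> e e0.
have na : 0 < normc a by rewrite normc_gt0.
have [d d0 dP] := cderiv_expC (a * z) (divr_gt0 e0 na).
exists (d / normc a); first exact: divr_gt0.
move=> h; rewrite ltr_pdivlMr // => hd; rewrite mulrDr -mulrA.
have -> : e * normc h = e / normc a * normc (a * h).
  by rewrite normcM mulrA divfK // gt_eqF.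
by apply: dP; rewrite normcM mulrC.
Qed.

End ComplexExponential.

Section LaplaceTransform.
Local Open Scope classical_set_scope.
Local Open Scope ring_scope.
Local Open Scope complex_scope.
Variable R : realType.
Local Notation C := R[i].
Local Notation mu := (@lebesgue_measure R).

Lemma cvgy_exp_decay (u : R -> R) (K c l : R) : 0 < c ->
  (forall t, 0 <= t -> `|u t - l| <= K * expR (- (c * t))) ->
  u x @[x --> +oo%R] --> l.
Proof.
move=> c0 ul; apply/cvgrPdist_le => e e0.
have K1 : 0 < `|K| + 1 by rewrite ltr_pwDr.
have ec : 0 < e / (`|K| + 1) by rewrite divr_gt0.
near=> t.
have t0 : 0 <= t by near: t; exact: nbhs_pinfty_ge.
rewrite distrC; apply: (le_trans (ul t t0)).
apply: (@le_trans _ _ ((`|K| + 1) * expR (- (c * t)))).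
  by rewrite ler_wpM2r ?expR_ge0 // (le_trans (ler_norm _)) // lerDl.
rewrite mulrC -ler_pdivlMr // expRN -[leRHS]invrK lef_pV2 ?posrE ?expR_gt0 ?invr_gt0 //.
apply: (@le_trans _ _ (c * t)); last by rewrite (le_trans _ (expR_ge1Dx _)) // lerDr.
by rewrite -ler_pdivrMl //; near: t; apply: nbhs_pinfty_ge; rewrite num_real.
Unshelve. all: by end_near. Qed.

(** The fundamental theorem on the half-line is applied to nonnegative functions only: u is written
    (u + v) - v, where v = K e^(-c t) dominates |u| and has an explicit primitive. *)
Lemma Rintegral_exp_decay (u U : R -> R) (K K' c l : R) : 0 < c ->
  (forall t : R, is_derive t 1 U (u t)) -> continuous u ->
  (forall t, 0 <= t -> `|u t| <= K * expR (- (c * t))) ->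
  (forall t, 0 <= t -> `|U t - l| <= K' * expR (- (c * t))) ->
  \int[mu]_(t in `[0, +oo[) u t = l - U 0.
Proof.
move=> c0 UD uC uK Ul.
have K0 : 0 <= K.
  by have := le_trans (normr_ge0 _) (uK 0 (lexx 0)); rewrite mulr0 oppr0 expR0 mulr1.
pose v t := K * expR (- (c * t)); pose V t := - (K / c) * expR (- (c * t)).
have v0 t : 0 <= v t by rewrite mulr_ge0 // expR_ge0.
have lin (t : R) : is_derive t 1 (fun s : R => - (c * s)) (- c).
  apply: rderiv_is_derive => e e0; exists 1 => // k _.
  rewrite (_ : _ - _ = 0); last ring.
  by rewrite normr0 mulr_ge0 // ltW.
have De (t : R) : is_derive t 1 (fun s : R => expR (- (c * s))) (expR (- (c * t)) * - c).
  exact: (is_derive1_comp (is_derive_expR _) (lin t)).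
have VD (t : R) : is_derive t 1 V (v t).
  have := is_deriveZ (- (K / c)) (De t); congr is_derive.
  by rewrite /v /GRing.scale /=; field; rewrite gt_eqF.
have vC : continuous v.
  by move=> t; have := is_derive_continuous (is_deriveZ K (De t)).
have UVD (t : R) : is_derive t 1 (U \+ V) (u t + v t) by exact: is_deriveD.
have V0 : V x @[x --> +oo%R] --> 0.
  apply: (@cvgy_exp_decay _ (K / c) _ _ c0) => t t0.
  by rewrite subr0 /V mulNr normrN ger0_norm // mulr_ge0 ?expR_ge0 // divr_ge0 // ltW.
have UV : (U \+ V) x @[x --> +oo%R] --> l + 0.
  by apply: cvgD V0; exact: (cvgy_exp_decay c0 Ul).
have ftc (g G : R -> R) (m : R) : (forall t : R, is_derive t 1 G (g t)) ->
    continuous g -> (forall t, 0 <= t -> 0 <= g t) -> G x @[x --> +oo%R] --> m ->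
    (\int[mu]_(x in `[0%R, +oo[) (g x)%:E = m%:E - (G 0)%:E)%E.
  move=> GD gC g0 Gm; apply: (ge0_continuous_FTC2y _ _ Gm).
  - exact: g0.
  - exact: continuous_subspaceT.
  - by move=> x _; case: (GD x).
  - apply: cvg_at_right_filter; exact: is_derive_continuous (GD 0).
  - by move=> x _; rewrite derive1E; case: (GD x).
have int (g : R -> R) (m : R) : continuous g -> (forall t, 0 <= t -> 0 <= g t) ->
    (\int[mu]_(x in `[0%R, +oo[) (g x)%:E = m%:E)%E ->
    mu.-integrable `[0, +oo[ (EFin \o g).
  move=> gC g0 gm; apply/integrableP; split.
    apply/measurable_EFinP; apply: measurable_funTS.
    exact: continuous_measurable_fun.
  have -> : (\int[mu]_(x in `[0%R, +oo[) `|(EFin \o g) x| = m%:E)%E; last exact: ltry.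
  rewrite -gm; apply: eq_integral => x.
  by rewrite inE /= in_itv /= andbT => x0; rewrite ger0_norm // g0.
have uvC : continuous (fun t => u t + v t) by move=> t; apply: cvgD; [exact: uC|exact: vC].
have uv0 t : 0 <= t -> 0 <= u t + v t.
  by move=> /uK; rewrite ler_norml -/(v t) => /andP[+ _]; rewrite -subr_ge0 opprK.
have I1 := ftc _ _ _ UVD uvC uv0 UV.
have I2 := ftc _ _ _ VD vC (fun t _ => v0 t) V0.
have J1 := int _ _ uvC uv0 I1.
have J2 := int _ _ vC (fun t _ => v0 t) I2.
transitivity (\int[mu]_(t in `[0, +oo[) ((u t + v t) - v t)).
  by apply: eq_Rintegral => t _; rewrite addrK.
by rewrite RintegralB // /Rintegral I1 I2 /= !addr0; ring.
Qed.

(** Induction on p: the induction hypothesis uses half of the exponent y, and the other half absorbs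
    the new factor t. *)
Lemma horner_exp_bound (p : {poly C}) (y : R) : 0 < y ->
  exists2 K : R, 0 <= K & forall t, 0 <= t -> normc p.[t%:C] <= K * expR (y * t).
Proof.
elim/poly_ind: p y => [|p c IH] y y0.
  by exists 0 => // t _; rewrite horner0 normc0 mul0r.
have y20 : 0 < y / 2 by rewrite divr_gt0.
have [K K0 KP] := IH _ y20.
exists (K * (2 / y) + normc c).
  by rewrite addr_ge0 ?normc_ge0 // mulr_ge0 // divr_ge0 // ltW.
move=> t t0; rewrite hornerMXaddC mulrDl; apply: (le_trans (normcDE _ _)).
have e1 : 1 <= expR (y * t) by rewrite -expR0 ler_expR mulr_ge0 // ltW.
apply: lerD; last by rewrite -[leLHS]mulr1 ler_wpM2l ?normc_ge0.
rewrite normcM normc_real ger0_norm //.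
have -> : expR (y * t) = expR (y / 2 * t) * expR (y / 2 * t).
  by rewrite -expRD; congr expR; field.
have te : t <= 2 / y * expR (y / 2 * t).
  rewrite -ler_pdivrMl ?divr_gt0 // invf_div mulrC mulrC.
  by apply: le_trans (expR_ge1Dx _); rewrite lerDr.
apply: (le_trans (ler_pM (normc_ge0 _) t0 (KP t t0) te)).
rewrite le_eqVlt; apply/orP; left; apply/eqP; ring.
Qed.

Lemma rderiv_exp_horner (p : {poly C}) (z : C) (t : R) :
  rderiv (fun s => expC (- (z * s%:C)) * p.[s%:C]) t
    (expC (- (z * t%:C)) * (p^`() - z *: p).[t%:C]).
Proof.
pose G w := expC (- z * w) * p.[w].
rewrite (_ : (fun s => _) = fun s => G (0 + s%:C * 1)); last first.
  by apply/funext => s; rewrite /G add0r mulr1 mulNr.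
set w := 0 + t%:C * 1.
have -> : expC (- (z * t%:C)) * (p^`() - z *: p).[t%:C] =
    (expC (- z * w) * - z * p.[w] + expC (- z * w) * p^`().[w]) * 1.
  by rewrite /w add0r !mulr1 mulNr hornerD hornerN hornerZ; ring.
apply: cderiv_line; apply: cderivM; [exact: cderiv_expC_linear|exact: cderiv_horner].
Qed.

(** H = sum_k z^(-k-1) p^(k) solves z H - H' = p, so - e^(-z t) H(t) is a primitive of the
    integrand, and it tends to 0. *)
Lemma laplace_poly (p : {poly C}) (z : C) : 0 < complex.Re z ->
  Cintegral `[0, +oo[ (fun t : R => expC (- (z * t%:C)) * p.[t%:C]) =
  \sum_(k < size p) k`!%:R * p`_k / z ^+ k.+1.
Proof.
move=> z0; have zn0 : z != 0 by apply: contraTneq z0 => ->; rewrite ltxx.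
pose H := \sum_(k < size p) z ^- k.+1 *: p^`(k).
have HE : z *: H - H^`() = p.
  rewrite /H scaler_sumr [deriv _]raddf_sum /= -sumrB.
  transitivity (\sum_(k < size p) (z ^- k *: p^`(k) - z ^- k.+1 *: p^`(k.+1))).
    apply: eq_bigr => k _; rewrite scalerA derivZ derivnS; congr (_ *: _ - _).
    by rewrite exprS invfM mulrA mulfV // mul1r.
  have -> : \sum_(k < size p) (z ^- k *: p^`(k) - z ^- k.+1 *: p^`(k.+1)) =
      - (z ^- size p *: p^`(size p) - z ^- 0 *: p^`(0)).
    rewrite -(telescope_sumr (fun k => z ^- k *: p^`(k)) (leq0n _)) big_mkord -sumrN.
    by apply: eq_bigr => k _; rewrite opprB.
  rewrite derivn_poly0 // scaler0 sub0r opprK expr0 invr1 scale1r; exact: derivn0.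
pose P t := expC (- (z * t%:C)) * (- H).[t%:C].
have PD t : rderiv P t (expC (- (z * t%:C)) * p.[t%:C]).
  have := rderiv_exp_horner (- H) z t; congr rderiv; congr (_ * _.[_]).
  by rewrite derivN scalerN opprK addrC HE.
have P0 : - P 0 = \sum_(k < size p) k`!%:R * p`_k / z ^+ k.+1.
  rewrite /P mulr0 oppr0 expC0 mul1r hornerN opprK /H horner_sum; apply: eq_bigr => k _.
  rewrite hornerZ horner_coef0 coef_derivn addn0 ffactnn -[p`_k *+ _]mulr_natl.
  by rewrite mulrC.
(* Half of the decay of e^(-z t) is given up to absorb the polynomial factor. *)
set x := complex.Re z in z0; have x20 : 0 < x / 2 by rewrite divr_gt0.
have nE t : 0 <= t -> normc (expC (- (z * t%:C))) * expR (x / 2 * t) = expR (- (x / 2 * t)).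
  move=> t0; rewrite normc_expC -expRD; congr expR.
  rewrite [z * _]mulrC (_ : complex.Re (- _) = - complex.Re (t%:C * z)); last by case: (_ * _).
  by rewrite ReM_real -/x; field.
have decay (q : {poly C}) : exists K, forall t, 0 <= t ->
   normc (expC (- (z * t%:C)) * q.[t%:C]) <= K * expR (- (x / 2 * t)).
  have [K K0 KP] := horner_exp_bound q x20; exists K => t t0.
  by rewrite normcM -nE // mulrCA ler_wpM2l ?normc_ge0 // KP.
have [K KP] := decay p; have [K' PK] := decay (- H).
pose f t := expC (- (z * t%:C)) * p.[t%:C].
(* Real and imaginary parts are treated at once, as Re (a w) with a = 1 and a = - i. *)
have part (r : C -> R) (a : C) : (forall w, r w = complex.Re (a * w)) ->
    (forall w, `|r w| <= normc w) ->
    \int[mu]_(t in `[0, +oo[) r (f t) = r (- P 0).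
  move=> rE rn; rewrite (_ : r (- P 0) = 0 - r (P 0)); last first.
    rewrite sub0r !rE mulrN; by case: (a * _).
  have rD (t : R) : is_derive t 1 (fun s : R => r (P s)) (r (f t)).
    have := rderiv_Re_is_derive a (PD t); rewrite -rE; congr is_derive.
    by apply/funext => s; rewrite rE.
  apply: (Rintegral_exp_decay x20 rD).
  - move=> t; have := rderiv_Re_is_derive a (rderiv_exp_horner p z t).
    move=> /is_derive_continuous; congr (continuous_at _ _).
    by apply/funext => s; rewrite rE.
  - by move=> t t0; apply: le_trans (rn _) (KP t t0).
  - by move=> t t0; rewrite subr0; apply: le_trans (rn _) (PK t t0).
rewrite /Cintegral -P0 -/f (part _ 1) ?(part _ (- 'i)) //.
- by case: (- P 0).
- by move=> [a b] /=; ring.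
- exact: Im_le_normc.
- by move=> w; rewrite mul1r.
- exact: Re_le_normc.
Qed.

End LaplaceTransform.

(** * The asymptotic expansion *)

Section Assembly.
Local Open Scope classical_set_scope.
Local Open Scope ring_scope.
Local Open Scope complex_scope.
Variable R : realType.
Local Notation C := R[i].

Lemma normc_le (a b : C) : `|a| <= b -> normc a <= normc b.
Proof.
move=> ab; have b0 := le_trans (normr_ge0 a) ab.
by move: ab; rewrite -[leRHS](ger0_norm b0) !normr_normc lecR.
Qed.

(** Induction along Horner's scheme: multiplication by X shifts the partial sums, and a constant
    term contributes the exponential series. *)
Lemma exp_conv_series (nu : nat -> C) (p : {poly C}) (z : C) (e : R) : 0 < e ->
  exists n0, forall n, (n0 <= n)%N ->
  normc (\sum_(j < n) exp_conv nu p j * z ^+ j - expC (nu 1%N * z) * p.[z]) <= e.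
Proof.
elim/poly_ind: p e => [|p c IH] e e0.
  exists 0%N => n _; rewrite horner0 mulr0 subr0 big1 ?normc0 ?ltW // => j _.
  by rewrite exp_conv0 mul0r.
have z1 : 0 < 2 * (normc z + 1) by rewrite mulr_gt0 // ltr_pwDr // normc_ge0.
have c1 : 0 < 2 * (normc c + 1) by rewrite mulr_gt0 // ltr_pwDr // normc_ge0.
have [n1 P1] := IH _ (divr_gt0 e0 z1).
have [n2 P2] := expC_series (nu 1%N * z) (divr_gt0 e0 c1).
exists (maxn n1.+1 n2) => -[|n]; first by rewrite leqNgt leq_max.
rewrite geq_max ltnS => /andP[/P1 H1 /P2 H2].
have -> : \sum_(j < n.+1) exp_conv nu (p * 'X + c%:P) j * z ^+ j =
    z * \sum_(j < n) exp_conv nu p j * z ^+ j +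
    c * \sum_(j < n.+1) (nu 1%N * z) ^+ j / j`!%:R.
  rewrite (eq_bigr (fun j : 'I_n.+1 => exp_conv nu ('X * p) j * z ^+ j +
      exp_conv nu c%:P j * z ^+ j)); last first.
    by move=> j _; rewrite exp_convD mulrDl [p * _]mulrC.
  rewrite big_split /=; congr (_ + _).
    rewrite big_ord_recl exp_convX0 mul0r add0r mulr_sumr; apply: eq_bigr => j _.
    by rewrite lift0 exp_convXS exprS mulrCA.
  rewrite mulr_sumr; apply: eq_bigr => j _.
  rewrite /exp_conv big_ord_recl coefC eqxx subn0 big1 => [|i _]; last first.
    by rewrite lift0 coefC !mul0r.
  by rewrite addr0 exprMn; ring.
set S1 := \sum_(j < n) _ in H1 *; set S2 := \sum_(j < n.+1) _ in H2 *.
have -> : z * S1 + c * S2 - expC (nu 1%N * z) * (p * 'X + c%:P).[z] =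
   z * (S1 - expC (nu 1%N * z) * p.[z]) + - (c * (expC (nu 1%N * z) - S2)).
  by rewrite hornerMXaddC; ring.
apply: (le_trans (normcDE _ _)); rewrite normcNE !normcM.
have -> : e = (normc z + 1) * (e / (2 * (normc z + 1))) +
   (normc c + 1) * (e / (2 * (normc c + 1))).
  have z0 : normc z + 1 != 0 by rewrite gt_eqF // ltr_pwDr // normc_ge0.
  have c0 : normc c + 1 != 0 by rewrite gt_eqF // ltr_pwDr // normc_ge0.
  by field; rewrite z0 c0.
by apply: lerD; apply: ler_pM; rewrite ?normc_ge0 ?lerDl.
Qed.

Section FixedRoots.
Variables (d : nat) (r : 'I_d -> C).
Hypothesis d_gt0 : (0 < d)%N.

(** Repeating the r_i makes Q^n a single product of d n factors X + t. *)
Definition roots_seq (n : nat) : seq C := iter n (cat [seq r i | i <- enum 'I_d]) [::].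

Lemma big_roots_seq (S : Type) (idx : S) (op : Monoid.com_law idx) (G : C -> S) n :
  \big[op/idx]_(t <- roots_seq n) G t = iterop n op (\big[op/idx]_(i < d) G (r i)) idx.
Proof.
have -> : iterop n op (\big[op/idx]_(i < d) G (r i)) idx =
   iter n (op (\big[op/idx]_(i < d) G (r i))) idx.
  by case: n => // n; rewrite iteropS iterSr Monoid.mulm1.
elim: n => [|n IH]; first by rewrite big_nil.
by rewrite /= big_cat big_map big_enum IH.
Qed.

Lemma size_roots_seq n : size (roots_seq n) = (d * n)%N.
Proof.
elim: n => [|n IH]; first by rewrite muln0.
by rewrite /= size_cat size_map size_enum_ord IH mulnS.
Qed.

Lemma mem_roots_seq n t : t \in roots_seq n -> exists i, t = r i.
Proof.
elim: n => [//|n IH]; rewrite /= mem_cat => /orP[/mapP[i _ ->]|/IH//].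
by exists i.
Qed.

Let c n j := (\prod_(t <- roots_seq n) (1 + t *: 'X) : {poly C})`_j.

Lemma QpolyX n : Qpoly r ^+ n = \prod_(t <- roots_seq n) ('X + t%:P).
Proof. by rewrite big_roots_seq. Qed.

Lemma size_Qpoly : size (Qpoly r) = d.+1.
Proof. by rewrite -[Qpoly r]expr1 QpolyX size_prod_XaddC size_roots_seq muln1. Qed.

(** The terms with j > d n vanish, which leaves J free to be taken as large as convergence in z
    requires. *)
Lemma Fn_vcoef n (z : C) J : 0 < complex.Re z -> (d * n < J)%N ->
  Fn (Qpoly r) n z = \sum_(j < J) vcoef (d * n) (c n) j * z ^+ j.
Proof.
move=> z0 NJ; have zn0 : z != 0 by apply: contraTneq z0 => ->; rewrite ltxx.
rewrite /Fn size_Qpoly /=; set N := (d * n)%N in NJ *.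
have sP : size (Qpoly r ^+ n) = N.+1.
  by rewrite QpolyX size_prod_XaddC size_roots_seq.
rewrite (_ : Cintegral _ _ =
    Cintegral `[0, +oo[ (fun t : R => expC (- (z * t%:C)) * (Qpoly r ^+ n).[t%:C])); last first.
  by congr Cintegral; apply/funext => t; rewrite horner_exp.
rewrite laplace_poly // sP mulr_sumr (reindex_inj rev_ord_inj) /=.
rewrite (big_ord_widen J (fun j => z ^+ (N + 1) / N`!%:R *
   ((N.+1 - j.+1)`!%:R * (Qpoly r ^+ n)`_(N.+1 - j.+1) / z ^+ (N.+1 - j.+1).+1))) //.
rewrite big_mkcond; apply: eq_bigr => j _; rewrite subSS ltnS; case: leqP => jN; last first.
  by rewrite /vcoef ffact_small // invr0 mulr0 mul0r.
have -> : (Qpoly r ^+ n)`_(N - j) = c n j.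
  rewrite QpolyX -{1}[N](size_roots_seq n) coef_prod_reverse //.
  by rewrite size_roots_seq.
rewrite /vcoef -(ffact_fact jN) natrM.
have -> : z ^+ (N + 1) = z ^+ (N - j).+1 * z ^+ j by rewrite -exprD addSn subnK // addn1.
field; rewrite expf_neq0 // !pnatr_eq0 -!lt0n fact_gt0 ffact_gt0 jN //.
Qed.

Let rho : C := \sum_(i < d) `|r i|.

Let rho_ge0 : 0 <= rho.
Proof. by apply: sumr_ge0. Qed.

Let r_le i : `|r i| <= rho.
Proof. by rewrite /rho (bigD1 i) //= lerDl sumr_ge0. Qed.

Let dN0 : d%:R != 0 :> C.
Proof. by rewrite pnatr_eq0 -lt0n. Qed.

Let mu_le s : `|mu r s.+1| <= rho ^+ s.+1.
Proof.
rewrite /mu normrM normfV normr_nat mulrC ler_pdivrMr ?ltr0n //.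
apply: (le_trans (ler_norm_sum _ _ _)).
apply: (@le_trans _ _ (\sum_(i < d) rho ^+ s.+1)).
  by apply: ler_sum => i _; rewrite normrX; apply: lerXn2r; rewrite ?nnegrE.
by rewrite sumr_const card_ord mulr_natr.
Qed.

Lemma roots_newton n j : j.+1%:R * c n j.+1 =
  \sum_(s < j.+1) (-1) ^+ s * ((d * n)%:R * mu r s.+1) * c n (j - s)%N.
Proof.
rewrite newton_coef; apply: eq_bigr => s _; congr (_ * _ * _).
by rewrite big_roots_seq -/(_ *+ n) natrM /mu mulrAC mulrA mulfV // mul1r mulr_natr.
Qed.

Lemma roots_c0 n : c n 0 = 1.
Proof.
rewrite /c -horner_coef0 horner_prod big1 // => t _.
by rewrite !hornerE ?mulr0 ?addr0.
Qed.

Lemma roots_c_le n j : `|c n j| <= 'C(d * n, j)%:R * rho ^+ j.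
Proof.
rewrite -(size_roots_seq n); apply: coef_prod_1addX_bound => t /mem_roots_seq[i ->].
exact: r_le.
Qed.

(** The error splits into the remainders of the coefficients, summed with weights y^j / j!, which
    give D K1, and the truncation of the L series in z, each within x^L, which give L. *)
Lemma Fn_expansion (z : C) L : 0 < complex.Re z ->
  exists2 K : R, 0 <= K & forall n, (0 < n)%N ->
  normc (Fn (Qpoly r) n z - \sum_(l < L) expC (mu r 1 * z) * (bpoly (mu r) l).[z] *
     (d * n)%:R ^- l) <= K * n%:R ^- L.
Proof.
move=> z0.
pose y := normc ((4 * 8 ^ L)%:R * rho) * normc z.
have y0 : 0 <= y by rewrite mulr_ge0 ?normc_ge0.
have [J1 J1P] := expC_series y%:C ltr01.
pose K1 := normc (expC y%:C) + 1.
have K1P J : (J1 <= J)%N -> \sum_(j < J) y ^+ j / j`!%:R <= K1.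
  move=> /J1P; rewrite normc_distC; set S := \sum_(j < J) _ => SP.
  have -> : \sum_(j < J) y ^+ j / j`!%:R = normc S.
    have -> : S = (\sum_(j < J) y ^+ j / j`!%:R)%:C.
      rewrite rmorph_sum; apply: eq_bigr => j _.
      by rewrite -(rmorph_nat (real_complex R)) -rmorphXn -fmorphV -rmorphM.
    rewrite normc_real ger0_norm //; apply: sumr_ge0 => j _.
    by rewrite divr_ge0 // exprn_ge0.
  have -> : S = (S - expC y%:C) + expC y%:C by ring.
  by apply: (le_trans (normcDE _ _)); rewrite addrC lerD2l.
have K10 : 0 <= K1 by rewrite addr_ge0 ?normc_ge0.
pose D : R := (2 ^ L * (L * L + L).+1)%:R.
exists (D * K1 + L%:R); first by rewrite addr_ge0 // mulr_ge0.
move=> n n0; have N0 : (0 < d * n)%N by rewrite muln_gt0 d_gt0.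
set N := (d * n)%N in N0 *.
pose x : C := N%:R^-1.
pose xr : R := N%:R^-1.
have xE : normc x = xr by rewrite normcV normc_nat.
have xr0 : 0 < xr by rewrite invr_gt0 ltr0n.
have xL0 : 0 < xr ^+ L by rewrite exprn_gt0.
pose A l := expC (mu r 1 * z) * (bpoly (mu r) l).[z].
have [Jl JlP] : exists Jl : nat -> nat, forall l J, (Jl l <= J)%N ->
    normc (\sum_(j < J) acoef (mu r) j l * z ^+ j - A l) <= xr ^+ L.
  have /choice[Jl JlP] : forall l, exists n0, forall J, (n0 <= J)%N ->
      normc (\sum_(j < J) acoef (mu r) j l * z ^+ j - A l) <= xr ^+ L.
    move=> l; have [n1 n1P] := exp_conv_series (mu r) (bpoly (mu r) l) z xL0.
    exists n1 => J /n1P; congr (normc (_ - _) <= _).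
    by apply: eq_bigr => j _; rewrite exp_conv_bpoly.
  by exists Jl.
(* J exceeds N and all the thresholds of convergence. It depends on n, but the constant D K1 + L
   does not. *)
pose J := (N.+1 + J1 + \sum_(l < L) Jl l)%N.
have JN : (N < J)%N by rewrite /J -addnA leq_addr.
have JJ1 : (J1 <= J)%N by rewrite /J addnAC leq_addl.
have JJl (l : 'I_L) : (Jl l <= J)%N.
  by rewrite /J (bigD1 l) //= addnCA leq_addr.
rewrite (Fn_vcoef z0 JN).
have -> : \sum_(j < J) vcoef N (c n) j * z ^+ j -
    \sum_(l < L) A l * N%:R ^- l =
  \sum_(j < J) (vcoef N (c n) j - \sum_(l < L) acoef (mu r) j l * x ^+ l) * z ^+ j
  + \sum_(l < L) (\sum_(j < J) acoef (mu r) j l * z ^+ j - A l) * x ^+ l.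
  have -> : \sum_(l < L) (\sum_(j < J) acoef (mu r) j l * z ^+ j - A l) * x ^+ l =
    \sum_(j < J) (\sum_(l < L) acoef (mu r) j l * x ^+ l) * z ^+ j - \sum_(l < L) A l * N%:R ^- l.
    rewrite (eq_bigr (fun l : 'I_L => \sum_(j < J) acoef (mu r) j l * z ^+ j * x ^+ l -
      A l * N%:R ^- l)); last first.
      by move=> l _; rewrite mulrBl mulr_suml /x exprVn.
    rewrite sumrB exchange_big; congr (_ - _); apply: eq_bigr => j _.
    by rewrite mulr_suml; apply: eq_bigr => l _; rewrite mulrAC.
  rewrite addrA -big_split; congr (_ - _); apply: eq_bigr => j _ /=; ring.
have normc_sum I (s : seq I) (f : I -> C) :
    normc (\sum_(i <- s) f i) <= \sum_(i <- s) normc (f i).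
  elim: s => [|i s IH]; first by rewrite !big_nil normc0.
  by rewrite !big_cons (le_trans (normcDE _ _)) // lerD2l.
apply: (@le_trans _ _ ((D * K1 + L%:R) * xr ^+ L)); last first.
  rewrite ler_wpM2l ?addr_ge0 ?mulr_ge0 // exprVn lef_pV2 ?posrE ?exprn_gt0 ?ltr0n //.
  by apply: lerXn2r; rewrite ?nnegrE // ler_nat leq_pmull.
apply: (le_trans (normcDE _ _)); rewrite mulrDl; apply: lerD.
  apply: (le_trans (normc_sum _ _ _)).
  apply: (@le_trans _ _ (\sum_(j < J) D * xr ^+ L * (y ^+ j / j`!%:R))).
    apply: ler_sum => j _; rewrite normcM normcX.
    have /normc_le H := vcoef_remainder rho_ge0 mu_le N0 (roots_c0 n)
      (roots_newton n) (roots_c_le n) j L.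
    apply: (le_trans (ler_wpM2r _ H)); first by rewrite exprn_ge0 ?normc_ge0.
    rewrite -/x /y; set q := (4 * 8 ^ L)%:R * rho.
    rewrite (normcM _ (j`!%:R)^-1) (normcM _ (q ^+ j)) (normcM (x ^+ L)) normcV.
    rewrite !normcX xE !normc_nat -/D exprMn.
    by rewrite le_eqVlt; apply/orP; left; apply/eqP; ring.
  by rewrite -mulr_sumr mulrAC ler_wpM2r ?(ltW xL0) // ler_wpM2l // K1P.
apply: (le_trans (normc_sum _ _ _)).
apply: (@le_trans _ _ (\sum_(l < L) xr ^+ L)).
  apply: ler_sum => l _; rewrite normcM normcX xE -[leRHS]mulr1.
  apply: ler_pM; rewrite ?normc_ge0 ?exprn_ge0 ?(ltW xr0) ?JlP //.
  by rewrite exprn_ile1 ?(ltW xr0) // invf_le1 ?ltr0n // ler1n.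
by rewrite sumr_const card_ord mulr_natl.
Qed.

End FixedRoots.

End Assembly.

Lemma universal_bpoly (F : numFieldType) (l : nat) :
  universal (nb_means l) (fun nu : nat -> F => bpoly nu l).
Proof.
case: l => [|l]; first exact: universal_cst.
apply: (@universal_sum _ _ _ (fun w nu => euler_poly nu (completep F (l.+1 - w)) (upoly nu w))).
by move=> w wl; apply: universal_euler_poly => //; exact: universal_upoly.
Qed.

(** * Uniqueness of the expansion and extension to the plane *)

Section Uniqueness.
Local Open Scope classical_set_scope.
Local Open Scope ring_scope.
Local Open Scope complex_scope.
Variable R : realType.
Local Notation C := R[i].
Variables (d : nat) (r : 'I_d -> C).
Hypothesis d_gt0 : (0 < d)%N.

(** The factor d^(-l) converts powers of 1 / (d n) into powers of 1 / n; the degree acts otherwise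
    only through the means. *)
Definition expansion_coef (l : nat) (z : C) : C :=
  expC (mu r 1 * z) * (bpoly (mu r) l).[z] * d%:R ^- l.

(** Once the lower coefficients agree, the difference of the two expansions is a multiple of n^(-l)
    and is also O(n^(-l-1)). *)
Lemma expansion_unique (A : nat -> C -> C) :
  is_asymptotic_expansion (Qpoly r) A ->
  forall z, 0 < complex.Re z -> forall l, A l z = expansion_coef l z.
Proof.
move=> AE z z0; elim/ltn_ind => l IH.
have [K K0 KP] := Fn_expansion r d_gt0 l.+1 z0.
have /eqO_exP[k k0 [n0 _ n0P]] := AE z z0 l.
pose k' := normc k.
have kE : k = k'%:C by rewrite /k' -normr_normc gtr0_norm.
have key n : (n0 <= n)%N -> (0 < n)%N ->
    normc (expansion_coef l z - A l z) <= (k' + K) / n%:R.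
  move=> nn npos; have := n0P n nn; rewrite kE !normr_normc -rmorphM lecR => H1.
  have := KP n npos => H2.
  have nn0 : 0 < (n%:R : R) by rewrite ltr0n.
  have nl0 : 0 < (n%:R : R) ^+ l by rewrite exprn_gt0.
  have E : \sum_(i < l.+1) expC (mu r 1 * z) * (bpoly (mu r) i).[z] * (d * n)%:R ^- i -
      \sum_(i < l.+1) A i z * n%:R ^- i = (expansion_coef l z - A l z) * n%:R ^- l.
    rewrite -sumrB big_ord_recr /= big1 ?add0r => [|i _].
      by rewrite /expansion_coef natrM exprMn invfM; ring.
    by rewrite IH // /expansion_coef natrM exprMn invfM; ring.
  have : normc ((expansion_coef l z - A l z) * n%:R ^- l) <= (k' + K) * n%:R ^- l.+1.
    rewrite -E; set S := \sum_(i < l.+1) expC _ * _ * _ in H2 *.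
    set T := \sum_(i < l.+1) _ in H1 *.
    have -> : S - T = (Fn (Qpoly r) n z - T) - (Fn (Qpoly r) n z - S) by ring.
    apply: (le_trans (normcDE _ _)); rewrite normcNE mulrDl; apply: lerD H2.
    by move: H1; rewrite normcV normcX normc_nat.
  rewrite normcM normcV normcX normc_nat exprS invfM mulrA.
  by rewrite ler_pM2r // invr_gt0.
apply/esym/eqP; rewrite -subr_eq0; apply/eqP/eq0_normc/eqP.
rewrite eq_le normc_ge0 andbT; apply/ler_addgt0Pr => e e0; rewrite add0r.
have kK : 0 <= (k' + K) / e by rewrite divr_ge0 ?addr_ge0 ?normc_ge0 // ltW.
pose n := maxn n0 (Num.bound ((k' + K) / e)).+1.
have npos : (0 < n)%N by rewrite leq_max orbT.
apply: (le_trans (key n (leq_maxl _ _) npos)).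
rewrite ler_pdivrMr ?ltr0n // mulrC -ler_pdivrMr //.
apply: (le_trans (ltW (archi_boundP kK))); rewrite ler_nat.
by rewrite (leq_trans (leqnSn _)) // leq_maxr.
Qed.

Lemma expansion_coef_cderiv l z : exists m, cderiv (expansion_coef l) z m.
Proof.
eexists; apply: cderivM; last exact: cderiv_cst.
by apply: cderivM; [exact: cderiv_expC_linear|exact: cderiv_horner].
Qed.

Lemma expansion_coef_unique (A : nat -> C -> C) :
  (forall j, entire (A j)) -> is_asymptotic_expansion (Qpoly r) A ->
  forall l z, A l z = expansion_coef l z.
Proof.
move=> Aent AE l z.
have /choice[m mP] : forall w, exists m,
    cderiv (fun w => A l w - expansion_coef l w) w m.
  move=> w; have [a aD] := entire_cderiv (Aent l) w.
  have [b bD] := expansion_coef_cderiv l w.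
  by exists (a - b); exact: cderivB.
apply/eqP; rewrite -subr_eq0; apply/eqP.
apply: (cderiv_eq0_half_plane mP) => w w0.
by rewrite (expansion_unique AE w0) subrr.
Qed.

End Uniqueness.

(** * Coefficients in C(d) and their values at the degree *)

Section Specialization.
Local Open Scope classical_set_scope.
Local Open Scope ring_scope.
Local Open Scope complex_scope.
Variables (F : numFieldType) (m k : nat) (B : {poly mpoly.mpoly m F}).

Definition tofracC (a : F) : {fraction {poly F}} := tofrac a%:P.

Lemma tofracC_is_additive : zmod_morphism tofracC.
Proof. by move=> a b; rewrite /tofracC polyCB rmorphB. Qed.

Lemma tofracC_is_multiplicative : monoid_morphism tofracC.
Proof. by split; [|move=> a b]; rewrite /tofracC ?polyCM ?rmorphM // rmorph1. Qed.

HB.instance Definition _ := GRing.isZmodMorphism.Build _ _ tofracC tofracC_is_additive.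
HB.instance Definition _ := GRing.isMonoidMorphism.Build _ _ tofracC tofracC_is_multiplicative.

(** The variable of the rational functions stands for the degree; the coefficients of [B] are
    constants, multiplied by X^(-k). *)
Definition generic_poly : {poly mpoly.mpoly m {fraction {poly F}}} :=
  \poly_(j < size B) ((tofrac 'X^k)^-1 *: mpoly.map_mpoly tofracC B`_j).

Definition special_poly (x : F) : {poly mpoly.mpoly m F} :=
  \poly_(j < size B) (x ^- k *: B`_j).

Lemma specialization_generic (x : F) : x != 0 ->
  specialization generic_poly x (special_poly x).
Proof.
move=> x0 j a; exists (mpoly.mcoeff a B`_j)%:P, 'X^k; split.
- by rewrite hornerXn expf_neq0.
- rewrite coef_poly; case: ltnP => jB.
    by rewrite mpoly.mcoeffZ mpoly.mcoeff_map_mpoly mulrC.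
  by rewrite mpoly.mcoeff0 nth_default // mpoly.mcoeff0 rmorph0 mul0r.
- rewrite coef_poly hornerC hornerXn; case: ltnP => jB.
    by rewrite mpoly.mcoeffZ mulrC.
  by rewrite mpoly.mcoeff0 nth_default // mpoly.mcoeff0 mul0r.
Qed.

Lemma map_special_poly (x : F) (v : 'I_m -> F) :
  map_poly (mpoly.meval v) (special_poly x) = x ^- k *: map_poly (mpoly.meval v) B.
Proof.
by apply/polyP => j; rewrite coefZ !coef_map; exact: (mpoly.mevalZ v).
Qed.

End Specialization.

Theorem theorem1p4 (R : realType) (k : nat) :
  exists B : {poly mpoly.mpoly (nb_means k) {fraction {poly R[i]}}},
  forall d : nat, (0 < d)%N ->
  exists E : {poly mpoly.mpoly (nb_means k) R[i]},
    specialization B d%:R E /\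
    forall (r : 'I_d -> R[i]) (A : nat -> R[i] -> R[i]),
      (forall j : nat, entire (A j)) ->
      is_asymptotic_expansion (Qpoly r) A ->
      forall z : R[i], A k z = expC (mu r 1 * z) * eval_at E r z.
Proof.
have [B BE] := @universal_bpoly R[i] k.
exists (generic_poly k B) => d d0; exists (special_poly k B d%:R); split.
  by apply: specialization_generic; rewrite pnatr_eq0 -lt0n.
move=> r A Aent AE z; rewrite (expansion_coef_unique d0 Aent AE).
rewrite /expansion_coef /eval_at map_special_poly hornerZ -BE.
by rewrite -mulrA [X in _ * X]mulrC.
Qed.
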